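(* For any $s,k\in\mathbb{N}$ there are $r,m_0,N\in\mathbb{N}$ such that the following holds. If $m\ge m_0$, $n\ge N\log m$, and for $j=1,2$ we have $R_j\subset[n]$ with $|R_j|\le k$ and $(r,m^{-k})$-uncapturable families $\mathcal{A}_j\subset[m]^{[n]\setminus R_j}$, then there are $x^1\in\mathcal{A}_1$, $x^2\in\mathcal{A}_2$ with $|\{i\in[n]\setminus(R_1\cup R_2): x^1_i=x^2_i\}|=s$.
   Context: $\mu$ is the uniform probability measure on $[m]^I$. A dictator in $[m]^I$ is a set $\{x\in[m]^I:x_i=a\}$ with $i\in I$, $a\in[m]$. A family $\mathcal{G}\subset[m]^I$ is $(r,\varepsilon)$-capturable if there is a set of at most $r$ dictators whose union $U$ satisfies $\mu(\mathcal{G}\setminus U)\le\varepsilon$; otherwise it is $(r,\varepsilon)$-uncapturable. *)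

(* Defs.v *)
From Stdlib Require Import Reals.
From mathcomp Require Import all_boot all_order all_algebra.
Set Implicit Arguments. Unset Strict Implicit. Unset Printing Implicit Defensive.
Import GRing.Theory Num.Theory.

(* [m]^I is modelled as {ffun I -> 'I_m}; [m] = {0,...,m-1}, [n] = 'I_n. *)

Definition dict_union (I : finType) (m : nat) (D : {set I * 'I_m})
  : {set {ffun I -> 'I_m}} := [set x : {ffun I -> 'I_m} | [exists p in D, x p.1 == p.2]].

Definition mu (I : finType) (m : nat) (G : {set {ffun I -> 'I_m}}) : rat :=
  (#|G|%:R / #|{: {ffun I -> 'I_m}}|%:R)%R.

Definition capturable (I : finType) (m r : nat) (eps : rat)
  (G : {set {ffun I -> 'I_m}}) : Prop :=
  exists D : {set I * 'I_m}, #|D| <= r /\ (mu (G :\: dict_union D) <= eps)%R.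

Definition uncapturable (I : finType) (m r : nat) (eps : rat)
  (G : {set {ffun I -> 'I_m}}) : Prop := ~ capturable r eps G.

Notation coords n R := {i : 'I_n | i \notin R}.

Definition agree_set (n m : nat) (R1 R2 : {set 'I_n})
  (x1 : {ffun coords n R1 -> 'I_m}) (x2 : {ffun coords n R2 -> 'I_m})
  : {set 'I_n} :=
  [set i : 'I_n | match @insub _ (fun j : 'I_n => j \notin R1) (coords n R1) i,
                         @insub _ (fun j : 'I_n => j \notin R2) (coords n R2) i with
                   | Some j1, Some j2 => x1 j1 == x2 j2
                   | _, _ => false end].

(* Main.v *)
Require Import Defs.
From Stdlib Require Import Reals Lra FunctionalExtensionality.
From mathcomp Require Import all_boot all_order all_algebra.
From mathcomp Require Import ring lra zify.
Set Implicit Arguments. Unset Strict Implicit. Unset Printing Implicit Defensive.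
Import Order.TTheory GRing.Theory Num.Theory.

(** A family is spread if fixing coordinates multiplies its measure by at most
    [L] per coordinate, where [L] is a small power of [m].  Each uncapturable
    family is made spread by passing to a densest restriction, relative to [L]
    to the number of fixed coordinates.  Uncapturability is used once: it lets
    the second family avoid the letters at which the first one was fixed.  The
    two bases are chosen [L1 << L2], so that fixing in the first family the
    coordinates of the second restriction costs little.  Since [log m] is small
    against [n], some free coordinate has a letter that is not rare in either
    family, and fixing [s] such letters produces the [s] agreements.

    It remains to find members of two spread families that differ everywhere.
    The density of such pairs is [<f1, T f2>], where [T] acts on each coordinate
    with eigenvalues [1] and [-1/(m-1)], so it is enough to bound the energy
    [<f, T_theta f>] by about the squared mean of [f], for some [theta] much
    larger than [1/m].  This is a self-improving estimate: by Hoelder the energy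
    is controlled by a high moment of [T_theta f], hypercontractivity bounds
    this moment by the 2-norms of the restricted derivatives of [f], and by
    spreadness these are in turn bounded by energies of restrictions of [f]. *)

Local Open Scope ring_scope.

(** * Inequalities between powers *)

Section PowerInequalities.
Variable R : realFieldType.
Implicit Types (A B c d z rho : R).

(** Convexity, by induction: multiplying the bound by [z] leaves the surplus
    [p.+1%:R * d ^+ p * (z - d) ^+ 2]. *)
Lemma tangent_pow z d p : 0 <= z -> 0 <= d ->
  d ^+ p.+1 + p.+1%:R * d ^+ p * (z - d) <= z ^+ p.+1.
Proof.
move=> z0 d0; elim: p => [|p IH]; first by rewrite expr0 !expr1; lra.
have H : z * (d ^+ p.+1 + p.+1%:R * d ^+ p * (z - d)) <= z ^+ p.+2.
  by rewrite (exprS z p.+1) ler_wpM2l.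
apply: le_trans H.
have H2 : 0 <= p.+1%:R * d ^+ p * (z - d) ^+ 2.
  by rewrite mulr_ge0 ?sqr_ge0 // mulr_ge0 ?ler0n ?exprn_ge0.
rewrite -subr_ge0.
rewrite (_ : _ - _ = p.+1%:R * d ^+ p * (z - d) ^+ 2) //.
rewrite !exprS -[p.+2]addn1 natrD; ring.
Qed.

(** Valid for [y] and [c] of any sign: apply [tangent_pow] to the squares, then use
    [2 * c * (y - c) <= y ^+ 2 - c ^+ 2]. *)
Lemma tangent_even_pow (y c : R) p :
  c ^+ (2 * p.+1) + (2 * p.+1)%:R * c ^+ (2 * p).+1 * (y - c) <= y ^+ (2 * p.+1).
Proof.
rewrite !exprM; apply: le_trans (tangent_pow p (sqr_ge0 y) (sqr_ge0 c)).
rewrite lerD2l natrM.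
have -> : c ^+ (2 * p).+1 = (c ^+ 2) ^+ p * c by rewrite exprSr exprM.
have H : 0 <= p.+1%:R * (c ^+ 2) ^+ p * (y - c) ^+ 2.
  by rewrite mulr_ge0 ?sqr_ge0 // mulr_ge0 ?ler0n // exprn_ge0 ?sqr_ge0.
rewrite -subr_ge0; apply: le_trans H _; rewrite le_eqVlt; apply/orP; left.
by apply/eqP; ring.
Qed.

Lemma mixed_powl A B p : 0 <= A -> 0 <= B ->
  A ^+ p * B ^+ 2 <= A ^+ p.+1 * B + B ^+ p.+2.
Proof.
move=> A0 B0; case: (lerP B A) => AB.
  apply: (@le_trans _ _ (A ^+ p.+1 * B)); last by rewrite lerDl exprn_ge0.
  by rewrite [A ^+ p.+1]exprSr -mulrA ler_wpM2l ?exprn_ge0 // expr2 ler_wpM2r.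
apply: (@le_trans _ _ (B ^+ p.+2)); last by rewrite lerDr mulr_ge0 ?exprn_ge0.
rewrite -[p.+2]addn2 exprD ler_wpM2r ?sqr_ge0 // lerXn2r ?nnegrE //; exact: ltW.
Qed.

Lemma mixed_powr A B p : 0 <= A -> 0 <= B ->
  A * B ^+ p.+1 <= A ^+ p.+1 * B + B ^+ p.+2.
Proof.
move=> A0 B0; case: (lerP B A) => AB.
  apply: (@le_trans _ _ (A ^+ p.+1 * B)); last by rewrite lerDl exprn_ge0.
  rewrite [A ^+ p.+1]exprS [B ^+ p.+1]exprSr mulrA ler_wpM2r // ler_wpM2l //.
  by rewrite lerXn2r ?nnegrE.
apply: (@le_trans _ _ (B ^+ p.+2)); last by rewrite lerDr mulr_ge0 ?exprn_ge0.
by rewrite [B ^+ p.+2]exprS ler_wpM2r ?exprn_ge0 // ltW.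
Qed.

(** [A], [B], [c] stand for [|u|^2], [|v|^2] and the inner product of [u] and [v], so the base on
    the left is [|u + rho v|^2]. The term linear in [c] is kept exactly, because it vanishes once
    [v] is averaged to zero. *)
Lemma one_dim_expansion p : exists2 C : nat, (0 < C)%N & forall A B c rho,
  0 <= A -> 0 <= B -> c ^+ 2 <= A * B -> 0 <= rho <= 1 ->
  (A + 2 * rho * c + rho ^+ 2 * B) ^+ p.+1 <=
    A ^+ p.+1 + 2 * p.+1%:R * rho * c * A ^+ p
    + C%:R * rho ^+ 2 * (A ^+ p * B + B ^+ p.+1).
Proof.
elim: p => [|p [C C0 IH]].
  exists 1%N => // A B c rho A0 B0 cAB /andP[r0 r1].
  rewrite !expr1 !expr0.
  have : 0 <= rho ^+ 2 * B by rewrite mulr_ge0 ?sqr_ge0.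
  lra.
(* The four summands pay for the error terms [t1] to [t4] below. *)
exists (1 + 4 * p.+1 + 2 * p.+1 + 8 * C)%N => // A B c rho A0 B0 cAB r01.
have /andP[r0 r1] := r01.
have c2 : `|2 * c| <= A + B.
  rewrite -(@ler_pXn2r _ 2) ?nnegrE ?normr_ge0 ?addr_ge0 // real_normK ?num_real //.
  have := sqr_ge0 (A - B); rewrite !expr2 in cAB *; lra.
have c2p : 2 * c <= A + B by apply: le_trans (ler_norm _) c2.
have c2n : - (A + B) <= 2 * c by move: c2; rewrite ler_norml => /andP[].
have r2 : rho ^+ 2 <= rho by rewrite expr2 ler_piMl.
have nn : 0 <= A + 2 * rho * c + rho ^+ 2 * B.
  case: (eqVneq A 0) => [A00|An0].
    have : c ^+ 2 <= 0 by rewrite A00 mul0r in cAB.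
    rewrite le_eqVlt ltNge sqr_ge0 orbF sqrf_eq0 => /eqP ->.
    by rewrite A00 mulr0 !add0r mulr_ge0 ?sqr_ge0.
  have A1 : 0 < A by rewrite lt_def An0.
  rewrite -(pmulr_rge0 _ A1).
  have : 0 <= (A + rho * c) ^+ 2 + rho ^+ 2 * (A * B - c ^+ 2).
    by rewrite addr_ge0 ?sqr_ge0 // mulr_ge0 ?sqr_ge0 // subr_ge0.
  suff -> : (A + rho * c) ^+ 2 + rho ^+ 2 * (A * B - c ^+ 2) =
     A * (A + 2 * rho * c + rho ^+ 2 * B) by [].
  ring.
have up : A + 2 * rho * c + rho ^+ 2 * B <= 2 * (A + B).
  have : rho * (2 * c) <= A + B.
    apply: le_trans (ler_norm _) _; rewrite normrM (ger0_norm r0).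
    by apply: le_trans c2; rewrite ler_piMl.
  have : rho ^+ 2 * B <= B by rewrite ler_piMl // (le_trans r2).
  lra.
rewrite exprSr.
apply: le_trans (ler_wpM2r nn (IH A B c rho A0 B0 cAB r01)) _.
set X := A + 2 * rho * c + rho ^+ 2 * B in nn up *.
set Ap := A ^+ p; have Ap0 : 0 <= Ap by rewrite exprn_ge0.
set Bp := B ^+ p.+1; have Bp0 : 0 <= Bp by rewrite exprn_ge0.
set Z := A ^+ p.+1 * B + B ^+ p.+2.
have m1 : Ap * B ^+ 2 <= Z by exact: mixed_powl.
have m2 : A * Bp <= Z by exact: mixed_powr.
have m3 : A * Ap * B <= Z.
  by rewrite /Ap -exprS lerDl exprn_ge0.
have m4 : B * Bp <= Z by rewrite /Bp -exprS lerDr mulr_ge0 ?exprn_ge0.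
have q2 : 0 <= rho ^+ 2 by rewrite sqr_ge0.
have t1 : rho ^+ 2 * (A * Ap * B) <= rho ^+ 2 * Z by rewrite ler_wpM2l.
have t2 : 4 * p.+1%:R * rho ^+ 2 * (c ^+ 2 * Ap) <= 4 * p.+1%:R * rho ^+ 2 * Z.
  rewrite ler_wpM2l ?mulr_ge0 ?ler0n //; apply: le_trans m3.
  by rewrite -mulrA [Ap * B]mulrC mulrA ler_wpM2r.
have t3 : 2 * p.+1%:R * rho ^+ 3 * (c * B * Ap) <= 2 * p.+1%:R * rho ^+ 2 * Z.
  have -> : 2 * p.+1%:R * rho ^+ 3 * (c * B * Ap) =
       p.+1%:R * rho ^+ 2 * (rho * ((2 * c) * B * Ap)) by ring.
  have -> : 2 * p.+1%:R * rho ^+ 2 * Z = p.+1%:R * rho ^+ 2 * (2 * Z) by ring.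
  rewrite ler_wpM2l ?mulr_ge0 ?ler0n //.
  have BA : 0 <= B * Ap by rewrite mulr_ge0.
  apply: (@le_trans _ _ (rho * ((A + B) * (B * Ap)))).
    by rewrite ler_wpM2l // -mulrA ler_wpM2r.
  apply: (@le_trans _ _ ((A + B) * (B * Ap))).
    by rewrite ler_piMl // mulr_ge0 // addr_ge0.
  suff -> : (A + B) * (B * Ap) = A * Ap * B + Ap * B ^+ 2 by lra.
  ring.
have t4 : C%:R * rho ^+ 2 * (Ap * B + Bp) * X <= 8 * C%:R * rho ^+ 2 * Z.
  have -> : 8 * C%:R * rho ^+ 2 * Z = C%:R * rho ^+ 2 * (8 * Z) by ring.
  rewrite -mulrA ler_wpM2l ?mulr_ge0 ?ler0n //.
  apply: le_trans (ler_wpM2l _ up) _; first by rewrite addr_ge0 // mulr_ge0.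
  suff -> : (Ap * B + Bp) * (2 * (A + B)) =
     2 * (A * Ap * B + Ap * B ^+ 2 + A * Bp + B * Bp) by lra.
  ring.
rewrite -/Z !natrD !natrM.
have -> : (A ^+ p.+1 + 2 * p.+1%:R * rho * c * Ap + C%:R * rho ^+ 2 * (Ap * B + Bp)) * X =
   A ^+ p.+2 + 2 * p.+2%:R * rho * c * A ^+ p.+1 + (rho ^+ 2 * (A * Ap * B)
   + 4 * p.+1%:R * rho ^+ 2 * (c ^+ 2 * Ap) + 2 * p.+1%:R * rho ^+ 3 * (c * B * Ap)
   + C%:R * rho ^+ 2 * (Ap * B + Bp) * X).
  rewrite /X /Ap !exprS -[p.+2]addn1 natrD; ring.
lra.
Qed.

(** With [rho = 1/C] the factor [C * rho ^ 2] is at most 1, which absorbs the constant. *)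
Lemma one_dim_pow p : exists2 C : nat, (0 < C)%N & forall A B c,
  0 <= A -> 0 <= B -> c ^+ 2 <= A * B ->
  (A + 2 * C%:R^-1 * c + C%:R^-1 ^+ 2 * B) ^+ p.+1 <=
    A ^+ p.+1 + 2 * p.+1%:R * C%:R^-1 * c * A ^+ p + (A ^+ p * B + B ^+ p.+1).
Proof.
have [C C0 H] := one_dim_expansion p; exists C => //.
have C1 : (1 : R) <= C%:R by rewrite ler1n.
move=> A B c A0 B0 cAB.
have r01 : 0 <= (C%:R^-1 : R) <= 1 by rewrite invr_ge0 ler0n invf_le1 // ltr0n.
apply: le_trans (H A B c _ A0 B0 cAB r01) _; rewrite lerD2l.
rewrite -[leRHS]mul1r ler_wpM2r //.
  by rewrite addr_ge0 ?mulr_ge0 ?exprn_ge0.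
rewrite expr2 mulrA mulfV ?mul1r; last by rewrite pnatr_eq0 -lt0n.
by rewrite invf_le1 // ltr0n.
Qed.

End PowerInequalities.

(** * Averages over words and noise operators *)

Section Averages.
Variables (R : realFieldType) (T : finType) (x0 : T).
Implicit Types (f g : seq T -> R) (p q : seq (option T)) (s w : seq T).

Lemma cardT_gt0 : 0 < #|T|%:R :> R.
Proof. by rewrite ltr0n; apply/card_gt0P; exists x0. Qed.

Definition mean (g : T -> R) : R := (\sum_a g a) / #|T|%:R.

Lemma meanD (g h : T -> R) : mean (fun a => g a + h a) = mean g + mean h.
Proof. by rewrite /mean big_split mulrDl. Qed.

Lemma meanZ c (g : T -> R) : mean (fun a => c * g a) = c * mean g.
Proof. by rewrite /mean -mulr_sumr mulrA. Qed.

Lemma meanB (g h : T -> R) : mean (fun a => g a - h a) = mean g - mean h.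
Proof. by rewrite /mean sumrB mulrBl. Qed.

Lemma mean_const c : mean (fun=> c) = c.
Proof.
rewrite /mean sumr_const -(mulr_natr c) mulfK //; exact: lt0r_neq0 cardT_gt0.
Qed.

Lemma le_mean (g h : T -> R) : (forall a, g a <= h a) -> mean g <= mean h.
Proof.
by move=> gh; rewrite ler_wpM2r ?invr_ge0 ?ler0n // ler_sum.
Qed.

Lemma mean_ge0 (g : T -> R) : (forall a, 0 <= g a) -> 0 <= mean g.
Proof. by move=> g0; rewrite mulr_ge0 ?invr_ge0 ?ler0n // sumr_ge0. Qed.

Lemma eq_mean (g h : T -> R) : g =1 h -> mean g = mean h.
Proof. by move=> gh; rewrite /mean (eq_bigr h). Qed.

Lemma mean_sum (J : finType) (F : J -> T -> R) :
  mean (fun a => \sum_j F j a) = \sum_j mean (F j).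
Proof. by rewrite /mean exchange_big mulr_suml. Qed.

(** The mean over the subcube of a pattern, in which [None] marks a free coordinate. Functions live
    on all lists, although only words of the length of the pattern matter, so that inductions can
    peel off the first coordinate. *)
Fixpoint pavg p f : R :=
  match p with
  | [::] => f [::]
  | Some a :: q => pavg q (fun s => f (a :: s))
  | None :: q => mean (fun a => pavg q (fun s => f (a :: s)))
  end.

Definition avg n := pavg (nseq n None).

Fixpoint matches p w : bool :=
  match p, w with
  | [::], [::] => true
  | o :: q, b :: s => (if o is Some a then b == a else true) && matches q s
  | _, _ => false
  end.

Lemma matches_size p w : matches p w -> size w = size p.
Proof. by elim: p w => [|o p IH] [|b w] //= /andP[_ /IH ->]. Qed.

Lemma matches_nth p w i a : matches p w -> nth None p i = Some a -> nth x0 w i = a.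
Proof.
elim: p w i => [|o p IH] [|b w] [|i] //= /andP[ob pw].
  by move=> oa; move: ob; rewrite oa => /eqP.
exact: IH.
Qed.

Lemma matches_nseq n w : matches (nseq n None) w = (size w == n).
Proof. by elim: n w => [|n IH] [|b w] //=; rewrite IH. Qed.

Lemma pavgD p f g : pavg p (fun w => f w + g w) = pavg p f + pavg p g.
Proof.
elim: p f g => [|[a|] p IH] f g //=.
by rewrite -meanD; apply: eq_mean => a; rewrite IH.
Qed.

Lemma pavgZ p c f : pavg p (fun w => c * f w) = c * pavg p f.
Proof.
elim: p f => [|[a|] p IH] f //=.
by rewrite -meanZ; apply: eq_mean => a; rewrite IH.
Qed.

Lemma pavgB p f g : pavg p (fun w => f w - g w) = pavg p f - pavg p g.
Proof.
rewrite -mulN1r -pavgZ -pavgD; congr pavg.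
by apply: functional_extensionality => w; rewrite mulN1r.
Qed.

Lemma pavg_const p c : pavg p (fun=> c) = c.
Proof.
by elim: p => [|[a|] p IH] //=; rewrite -[RHS]mean_const; apply: eq_mean.
Qed.

Lemma pavg_sum p (J : finType) (F : J -> seq T -> R) :
  pavg p (fun w => \sum_j F j w) = \sum_j pavg p (F j).
Proof.
elim: p F => [|[a|] p IH] F //=.
by rewrite -mean_sum; apply: eq_mean => a; rewrite IH.
Qed.

Lemma pavg_mean p (F : T -> seq T -> R) :
  pavg p (fun w => mean (fun a => F a w)) = mean (fun a => pavg p (F a)).
Proof.
rewrite /mean -pavg_sum mulrC -pavgZ; congr pavg.
by apply: functional_extensionality => w; rewrite mulrC.
Qed.

Lemma le_pavg p f g : (forall w, matches p w -> f w <= g w) -> pavg p f <= pavg p g.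
Proof.
elim: p f g => [|[a|] p IH] f g fg /=; first exact: fg.
  by apply: IH => w pw; apply: fg; rewrite /= eqxx.
by apply: le_mean => a; apply: IH => w pw; apply: fg.
Qed.

Lemma pavg_ge0 p f : (forall w, matches p w -> 0 <= f w) -> 0 <= pavg p f.
Proof. by move=> f0; rewrite -(pavg_const p 0); apply: le_pavg. Qed.

Lemma eq_pavg p f g : (forall w, matches p w -> f w = g w) -> pavg p f = pavg p g.
Proof.
by move=> fg; apply/eqP; rewrite eq_le !le_pavg // => w /fg ->.
Qed.

Definition cons_avg f := fun s => mean (fun a => f (a :: s)).
(** With [cons_avg], the orthogonal decomposition of [f] along its first coordinate. *)
Definition dev a f := fun s => f (a :: s) - cons_avg f s.

Lemma mean_dev f s : mean (fun a => dev a f s) = 0.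
Proof. by rewrite /dev meanB mean_const subrr. Qed.

Lemma cons_avgE f a s : f (a :: s) = cons_avg f s + dev a f s.
Proof. by rewrite /dev addrC subrK. Qed.

Lemma cons_avg_lin c d f g :
  cons_avg (fun s => c * f s + d * g s) = fun s => c * cons_avg f s + d * cons_avg g s.
Proof.
by apply: functional_extensionality => s; rewrite /cons_avg meanD !meanZ.
Qed.

Lemma dev_lin c d f g a :
  dev a (fun s => c * f s + d * g s) = fun s => c * dev a f s + d * dev a g s.
Proof.
apply: functional_extensionality => s; rewrite /dev cons_avg_lin; ring.
Qed.

Lemma avgS n f : avg n.+1 f = avg n (cons_avg f).
Proof. by rewrite /avg /= -pavg_mean. Qed.

(* [noise r] acts on every coordinate as [E + r (1 - E)], where [E] averages
   over that coordinate. *)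
Fixpoint noise (r : R) n f : seq T -> R :=
  match n with
  | 0 => f
  | n'.+1 => fun w => if w is a :: s then
      noise r n' (fun t => cons_avg f t + r * dev a f t) s else 0
  end.

Lemma noise_lin r n c d f g :
  noise r n (fun s => c * f s + d * g s) =
  fun s => c * noise r n f s + d * noise r n g s.
Proof.
elim: n f g => [|n IH] f g //.
apply: functional_extensionality => -[|a s] /=; first by rewrite !mulr0 addr0.
rewrite cons_avg_lin dev_lin.
rewrite (_ : (fun t => _) = (fun t => c * (cons_avg f t + r * dev a f t)
   + d * (cons_avg g t + r * dev a g t))) ?IH //.
by apply: functional_extensionality => t; ring.
Qed.

Lemma noiseZ r n c f : noise r n (fun s => c * f s) = fun s => c * noise r n f s.
Proof.
have -> : (fun s => c * f s) = (fun s => c * f s + 0 * f s).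
  by apply: functional_extensionality => s; rewrite mul0r addr0.
rewrite noise_lin; apply: functional_extensionality => s.
by rewrite mul0r addr0.
Qed.

Lemma noiseDZ r n d f g :
  noise r n (fun s => f s + d * g s) = fun s => noise r n f s + d * noise r n g s.
Proof.
have -> : (fun s => f s + d * g s) = (fun s => 1 * f s + d * g s).
  by apply: functional_extensionality => s; rewrite mul1r.
rewrite noise_lin; apply: functional_extensionality => s.
by rewrite mul1r.
Qed.

Lemma noise_sum r n (J : finType) (F : J -> seq T -> R) :
  noise r n (fun s => \sum_j F j s) = fun s => \sum_j noise r n (F j) s.
Proof.
elim: n F => [|n IH] F //.
apply: functional_extensionality => -[|a s] /=; first by rewrite big1.
have E : cons_avg (fun s => \sum_j F j s) = fun t => \sum_j cons_avg (F j) t.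
  by apply: functional_extensionality => t; rewrite /cons_avg mean_sum.
rewrite (_ : (fun t => _) = (fun t => \sum_j (cons_avg (F j) t + r * dev a (F j) t))).
  by rewrite IH.
apply: functional_extensionality => t.
by rewrite /dev E big_split /= -mulr_sumr sumrB.
Qed.

Lemma noise_mean r n (F : T -> seq T -> R) :
  noise r n (fun s => mean (fun a => F a s)) = fun s => mean (fun a => noise r n (F a) s).
Proof.
rewrite /mean (_ : (fun s => _) = (fun s => #|T|%:R^-1 * \sum_a F a s)).
  rewrite noiseZ noise_sum.
  by apply: functional_extensionality => s; rewrite mulrC.
by apply: functional_extensionality => s; rewrite mulrC.
Qed.

Lemma cons_noise r n f a :
  (fun s => noise r n.+1 f (a :: s)) =
  fun s => noise r n (cons_avg f) s + r * noise r n (dev a f) s.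
Proof. by rewrite /= noiseDZ. Qed.

Lemma mean_noise_dev r n f s : mean (fun a => noise r n (dev a f) s) = 0.
Proof.
have := noise_mean r n (fun a s => dev a f s).
move/(congr1 (@^~ s)) => <-.
rewrite (_ : (fun s => _) = (fun s => 0 * f s)) ?noiseZ ?mul0r //.
by apply: functional_extensionality => t; rewrite mean_dev mul0r.
Qed.

Lemma cons_avg_noise r n f : cons_avg (noise r n.+1 f) = noise r n (cons_avg f).
Proof.
apply: functional_extensionality => s; rewrite /cons_avg.
rewrite (eq_mean (h := fun a => noise r n (cons_avg f) s + r * noise r n (dev a f) s)).
  by rewrite meanD meanZ mean_noise_dev mulr0 addr0 mean_const.
by move=> a; have := cons_noise r n f a => /(congr1 (@^~ s)) /= ->.
Qed.

Lemma dev_noise r n f a : dev a (noise r n.+1 f) = fun s => r * noise r n (dev a f) s.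
Proof.
apply: functional_extensionality => s; rewrite /dev cons_avg_noise.
have := cons_noise r n f a => /(congr1 (@^~ s)) -> /=.
by rewrite addrC addrA addNr add0r.
Qed.

Lemma noise_comp r t n f : noise r n (noise t n f) = noise (r * t) n f.
Proof.
elim: n f => [|n IH] f //.
apply: functional_extensionality => -[|a s] //.
have := cons_noise r n (noise t n.+1 f) a => /(congr1 (@^~ s)) ->.
have := cons_noise (r * t) n f a => /(congr1 (@^~ s)) ->.
by rewrite cons_avg_noise dev_noise noiseZ !IH mulrA.
Qed.

Definition corr r n f g := avg n (fun s => f s * noise r n g s).

(** The cross terms vanish: deviations have mean zero over the first letter, before and after noise
    on the other coordinates. *)
Lemma corrS r n f g : corr r n.+1 f g =
  corr r n (cons_avg f) (cons_avg g) + r * mean (fun a => corr r n (dev a f) (dev a g)).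
Proof.
rewrite /corr avgS -meanZ.
under [X in _ + X]eq_mean => a do rewrite -pavgZ.
rewrite -pavg_mean -pavgD; apply: eq_pavg => s _.
rewrite /cons_avg.
rewrite (eq_mean (h := fun a =>
  cons_avg f s * noise r n (cons_avg g) s + (cons_avg f s * r) * noise r n (dev a g) s
  + (noise r n (cons_avg g) s * dev a f s + r * (dev a f s * noise r n (dev a g) s)))).
  by rewrite !meanD mean_const !meanZ mean_noise_dev mean_dev !mulr0 addr0 add0r.
move=> a; have := cons_noise r n g a => /(congr1 (@^~ s)) ->.
rewrite cons_avgE; ring.
Qed.

End Averages.

(** * Hypercontractivity *)

(** Lagrange's identity: the difference of the two sides is half of the double sum of squares in
    [H]. *)
Lemma weighted_cauchy_schwarz (R : realFieldType) (J : finType) (w u v : J -> R) :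
  (forall j, 0 <= w j) ->
  (\sum_j w j * (u j * v j)) ^+ 2 <= (\sum_j w j * u j ^+ 2) * (\sum_j w j * v j ^+ 2).
Proof.
move=> w0.
have H : 0 <= \sum_i \sum_j w i * w j * (u i * v j - u j * v i) ^+ 2.
  by apply: sumr_ge0 => i _; apply: sumr_ge0 => j _; rewrite mulr_ge0 ?sqr_ge0 ?mulr_ge0.
have E1 : \sum_i \sum_j w i * w j * (u i * v j - u j * v i) ^+ 2 =
   (\sum_i \sum_j (w i * u i ^+ 2) * (w j * v j ^+ 2)
   + \sum_i \sum_j (w i * v i ^+ 2) * (w j * u j ^+ 2))
   - 2 * \sum_i \sum_j (w i * (u i * v i)) * (w j * (u j * v j)).
  rewrite mulr_sumr -big_split -sumrB; apply: eq_bigr => i _.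
  rewrite mulr_sumr -big_split -sumrB; apply: eq_bigr => j _ /=; ring.
move: H; rewrite E1 -!big_distrlr /= expr2.
lra.
Qed.

Section Hypercontractivity.
Variables (R : realFieldType) (T : finType) (x0 : T).
Implicit Types (f g : seq T -> R) (q : seq (option T)) (s : seq T).

(** The squared 2-norm of the derivative of [f] at the letters of [q]; at a [None] the norm is split
    by Pythagoras. *)
Fixpoint deriv_energy q f : R :=
  match q with
  | [::] => f [::] ^+ 2
  | Some a :: q' => deriv_energy q' (dev a f)
  | None :: q' => deriv_energy q' (cons_avg f) + mean (fun a => deriv_energy q' (dev a f))
  end.

(* The sum over all sets [S] of coordinates of the squared norms of the
   [S]-derivatives of [f]. *)
Fixpoint total_energy n f : R :=
  match n with
  | 0 => f [::] ^+ 2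
  | n'.+1 => total_energy n' (cons_avg f) + 2 * mean (fun a => total_energy n' (dev a f))
  end.

Lemma mean_sum_weighted (J : finType) (w : J -> R) (G : T -> J -> R) :
  mean (fun a => \sum_j w j * G a j) = \sum_j w j * mean (fun a => G a j).
Proof.
rewrite (mean_sum (fun j a => w j * G a j)).
by apply: eq_bigr => j _; rewrite meanZ.
Qed.

(** The inner products [c a] average to zero. By convexity the remaining
    [A ^+ p.+1 + A ^+ p * mean B] is at most [(A + mean B) ^+ p.+1]. *)
Lemma one_coord_hypercontractive p rho :
  (forall A B c : R, 0 <= A -> 0 <= B -> c ^+ 2 <= A * B ->
  (A + 2 * rho * c + rho ^+ 2 * B) ^+ p.+1 <=
    A ^+ p.+1 + 2 * p.+1%:R * rho * c * A ^+ p + (A ^+ p * B + B ^+ p.+1)) ->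
  forall (J : finType) (w u : J -> R) (v : T -> J -> R),
  (forall j, 0 <= w j) -> (forall j, mean (fun a => v a j) = 0) ->
  mean (fun a => (\sum_j w j * (u j + rho * v a j) ^+ 2) ^+ p.+1) <=
  (\sum_j w j * u j ^+ 2 + mean (fun a => \sum_j w j * v a j ^+ 2)) ^+ p.+1
  + mean (fun a => (\sum_j w j * v a j ^+ 2) ^+ p.+1).
Proof.
move=> H1 J w u v w0 v0.
set A := \sum_j w j * u j ^+ 2.
pose B a := \sum_j w j * v a j ^+ 2; pose c a := \sum_j w j * (u j * v a j).
have A0 : 0 <= A by apply: sumr_ge0 => j _; rewrite mulr_ge0 ?sqr_ge0.
have B0 a : 0 <= B a by apply: sumr_ge0 => j _; rewrite mulr_ge0 ?sqr_ge0.
have c0 : mean c = 0.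
  rewrite /c mean_sum_weighted big1 // => j _.
  by rewrite meanZ v0 !mulr0.
apply: (@le_trans _ _ (mean (fun a => (A ^+ p.+1 + 2 * p.+1%:R * rho * A ^+ p * c a)
    + (A ^+ p * B a + B a ^+ p.+1)))).
  apply: le_mean => a.
  have -> : \sum_j w j * (u j + rho * v a j) ^+ 2 = A + 2 * rho * c a + rho ^+ 2 * B a.
    rewrite /A /B /c !mulr_sumr -!big_split; apply: eq_bigr => j _ /=; ring.
  have -> : 2 * p.+1%:R * rho * A ^+ p * c a = 2 * p.+1%:R * rho * c a * A ^+ p by ring.
  by apply: H1 => //; exact: weighted_cauchy_schwarz.
rewrite !meanD !meanZ c0 mulr0 addr0 (mean_const x0) addrA lerD2r.
have mB0 : 0 <= mean B by apply: mean_ge0.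
have := tangent_pow p (addr_ge0 A0 mB0) A0.
apply: le_trans; rewrite lerD2l addrAC subrr add0r ler_wpM2r //.
by rewrite ler_peMl ?exprn_ge0 // ler1n.
Qed.

(* The function is vector valued, with values in a weighted Euclidean space,
   so that in the induction the average and the deviations along a coordinate
   can be stored as further components. *)
Theorem hypercontractive p rho :
  (forall A B c : R, 0 <= A -> 0 <= B -> c ^+ 2 <= A * B ->
  (A + 2 * rho * c + rho ^+ 2 * B) ^+ p.+1 <=
    A ^+ p.+1 + 2 * p.+1%:R * rho * c * A ^+ p + (A ^+ p * B + B ^+ p.+1)) ->
  forall n (J : finType) (w : J -> R) (F : J -> seq T -> R) (M : R),
  (forall j, 0 <= w j) ->
  (forall q, size q = n -> \sum_j w j * deriv_energy q (F j) <= M) ->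
  avg n (fun s => (\sum_j w j * noise rho n (F j) s ^+ 2) ^+ p.+1)
    <= M ^+ p * \sum_j w j * total_energy n (F j).
Proof.
move=> H1; elim=> [|n IH] J w F M w0 HM.
  rewrite /avg /= exprSr.
  have X0 : 0 <= \sum_j w j * F j [::] ^+ 2.
    by apply: sumr_ge0 => j _; rewrite mulr_ge0 ?sqr_ge0.
  rewrite ler_wpM2r // lerXn2r ?nnegrE // ?(le_trans X0) //; exact: (HM [::]).
have m0 := cardT_gt0 R x0.
rewrite avgS.
(* The components [inr (a, j)] have weight [w j / #|T|], so a weighted sum over [J'] contains the
   mean over [a] of the deviations. *)
pose J' : finType := (J + T * J)%type.
pose w' (i : J') := match i with inl j => w j | inr k => w k.2 / #|T|%:R end.
pose F' (i : J') := match i with inl j => cons_avg (F j) | inr k => dev k.1 (F k.2) end.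
have sum' (G : J' -> R) : \sum_i w' i * G i =
    \sum_j w j * G (inl j) + mean (fun a => \sum_j w j * G (inr (a, j))).
  rewrite big_sumType /=; congr (_ + _).
  rewrite /mean pair_bigA /= mulr_suml.
  by apply: eq_bigr => -[a j] _ /=; rewrite mulrAC.
have w'0 i : 0 <= w' i.
  by case: i => [j|[a j]] //=; rewrite divr_ge0 // ltW.
apply: (@le_trans _ _ (avg n (fun s => (\sum_i w' i * noise rho n (F' i) s ^+ 2) ^+ p.+1)
   + mean (fun a => avg n (fun s =>
        (\sum_j w j * noise rho n (dev a (F j)) s ^+ 2) ^+ p.+1)))).
  rewrite /avg -pavg_mean -pavgD; apply: le_pavg => s _.
  rewrite sum' /=.
  have := one_coord_hypercontractive H1 (fun j => noise rho n (cons_avg (F j)) s)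
     (v := fun a j => noise rho n (dev a (F j)) s) w0.
  move=> /(_ (fun j => mean_noise_dev x0 rho n (F j) s)); apply: le_trans.
  rewrite le_eqVlt; apply/orP; left; apply/eqP.
  apply: eq_mean => a; congr (_ ^+ _); apply: eq_bigr => j _.
  by rewrite /= noiseDZ.
(* The induction hypothesis serves the enlarged vector, through the patterns [None :: q], and the
   deviations at each letter, through [Some a :: q]. Deviations are thus counted twice, hence the 2
   in [total_energy]. *)
have IH1 := IH J' w' F' M w'0; have IH2 a := IH J w (fun j => dev a (F j)) M w0.
apply: (@le_trans _ _ (M ^+ p * (\sum_i w' i * total_energy n (F' i)) +
   mean (fun a => M ^+ p * \sum_j w j * total_energy n (dev a (F j))))).
  apply: lerD.
    apply: IH1 => q qn; rewrite sum' /=.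
    have := HM (None :: q); rewrite /= qn => /(_ erefl); apply: le_trans.
    rewrite mean_sum_weighted -big_split /= le_eqVlt; apply/orP; left; apply/eqP.
    by apply: eq_bigr => j _; rewrite mulrDr.
  apply: le_mean => a; apply: IH2 => q qn.
  by have := HM (Some a :: q); rewrite /= qn => /(_ erefl).
rewrite meanZ -mulrDr sum' /= !mean_sum_weighted -!big_split /=.
rewrite le_eqVlt; apply/orP; left; apply/eqP; congr (_ * _).
apply: eq_bigr => j _; ring.
Qed.

End Hypercontractivity.

(** * Energy of spread functions *)

Section Subcubes.
Variables (R : realFieldType) (T : finType) (x0 : T).
Implicit Types (f g : seq T -> R) (p q : seq (option T)) (s y : seq T).

Definition nfix p := count isSome p.
Definition nfree p := count (fun o => ~~ isSome o) p.

Lemma nfix_nfree p : (nfix p + nfree p)%N = size p.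
Proof. exact: count_predC. Qed.

Fixpoint fill p y : seq T :=
  match p with
  | [::] => [::]
  | Some a :: q => a :: fill q y
  | None :: q => head x0 y :: fill q (behead y)
  end.

Fixpoint combine p q : seq (option T) :=
  match p with
  | [::] => [::]
  | Some a :: p' => Some a :: combine p' q
  | None :: p' => head None q :: combine p' (behead q)
  end.

Lemma matches_fill p y : size y = nfree p -> matches p (fill p y).
Proof.
rewrite /nfree; elim: p y => [|[a|] p IH] [|b y] //= sy; rewrite ?eqxx /=.
all: by apply: IH => //=; move: sy; rewrite ?add0n // add1n => -[].
Qed.

Lemma size_combine p q : size (combine p q) = size p.
Proof. by elim: p q => [|[a|] p IH] q //=; rewrite IH. Qed.

Lemma nfix_combine p q : size q = nfree p -> nfix (combine p q) = (nfix p + nfix q)%N.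
Proof.
rewrite /nfix /nfree; elim: p q => [|[a|] p IH] q /= sq.
- by case: q sq.
- by rewrite IH // addnA.
case: q sq => [|o q] //=; rewrite add1n => -[sq].
by rewrite IH // add0n addnCA.
Qed.

Lemma pavg_fill p q f : size q = nfree p ->
  pavg q (fun y => f (fill p y)) = pavg (combine p q) f.
Proof.
rewrite /nfree; elim: p q f => [|[a|] p IH] q f /= sq.
- by case: q sq.
- exact: (IH q (fun s => f (a :: s)) sq).
case: q sq => [|[b|] q] //=; rewrite add1n => -[sq].
  exact: (IH q (fun s => f (b :: s)) sq).
by apply: eq_mean => b; exact: (IH q (fun s => f (b :: s)) sq).
Qed.

Lemma nth_combine_fixed p q i a : nth None p i = Some a -> nth None (combine p q) i = Some a.
Proof.
by elim: p q i => [|[b|] p IH] q [|i] //=; exact: IH.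
Qed.

Lemma fill_differ p1 p2 y1 y2 i :
  map isSome p1 = map isSome p2 -> size y1 = nfree p1 -> size y2 = nfree p2 ->
  all2 (fun a b => a != b) y1 y2 -> (i < size p1)%N -> nth None p1 i = None ->
  nth x0 (fill p1 y1) i != nth x0 (fill p2 y2) i.
Proof.
elim: p1 p2 y1 y2 i => [|o1 p1 IH] [|o2 p2] y1 y2 i //= [o12 p12].
case: o1 o12 => [a|]; case: o2 => [b|] //= _.
  by move=> s1 s2 y12; case: i => [|i] //= ip pi; apply: IH.
case: y1 y2 => [|a y1] [|b y2] //= [s1] [s2] /andP[ab y12].
by case: i => [|i] //= ip pi; apply: IH.
Qed.

End Subcubes.

(** * Energies under restriction and differentiation *)

Section Energy.
Variables (R : realFieldType) (T : finType) (x0 : T).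
Implicit Types (f g : seq T -> R) (p q : seq (option T)) (s y : seq T).

(* A word of letters tells for each coordinate whether it is kept, fixed, or
   differentiated. *)
Inductive letter := Free | Fix of T | Der of T.
Implicit Types l : seq letter.

Variables theta tau : R.
Hypotheses (theta0 : 0 <= theta).

(** Free coordinates give the quadratic form of [noise theta]; a derivative carries the factor
    [tau ^+ 2] by which [noise tau] shrinks its square. *)
Fixpoint energy l f : R :=
  match l with
  | [::] => f [::] ^+ 2
  | Free :: l' => energy l' (cons_avg f) + theta * mean (fun a => energy l' (dev a f))
  | Fix a :: l' => energy l' (fun s => f (a :: s))
  | Der a :: l' => tau ^+ 2 * energy l' (dev a f)
  end.

Definition fix_letter (o : option T) := if o is Some a then Fix a else Free.
Definition der_letter (o : option T) := if o is Some a then Der a else Free.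

Lemma energy_ge0 l f : 0 <= energy l f.
Proof.
elim: l f => [|[|a|a] l IH] f /=; rewrite ?sqr_ge0 //; last first.
  by rewrite mulr_ge0 ?sqr_ge0.
by rewrite addr_ge0 // mulr_ge0 // mean_ge0.
Qed.

Lemma cons_avgB f g : cons_avg (fun s => f s - g s) = fun s => cons_avg f s - cons_avg g s.
Proof. by apply: functional_extensionality => s; rewrite /cons_avg meanB. Qed.

Lemma devB a f g : dev a (fun s => f s - g s) = fun s => dev a f s - dev a g s.
Proof.
apply: functional_extensionality => s; rewrite /dev cons_avgB; ring.
Qed.

Lemma energyB l f g : energy l (fun s => f s - g s) <= 2 * energy l f + 2 * energy l g.
Proof.
elim: l f g => [|[|a|a] l IH] f g /=.
- by have := sqr_ge0 (f [::] + g [::]); rewrite !expr2; lra.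
- rewrite cons_avgB.
  have H : mean (fun a => energy l (dev a (fun s => f s - g s))) <=
    2 * mean (fun a => energy l (dev a f)) + 2 * mean (fun a => energy l (dev a g)).
    rewrite -!meanZ -meanD; apply: le_mean => a; rewrite devB; exact: IH.
  have := ler_wpM2l theta0 H; have := IH (cons_avg f) (cons_avg g); lra.
- exact: IH.
- rewrite devB.
  have := ler_wpM2l (sqr_ge0 tau) (IH (dev a f) (dev a g)); lra.
Qed.

Lemma energy_cons_avg l f : energy l (cons_avg f) <= energy (Free :: l) f.
Proof.
by rewrite /= lerDl mulr_ge0 // mean_ge0 // => a; exact: energy_ge0.
Qed.

(** A derivative is a restriction minus an average, so [energyB] applies; the energy of the average
    is part of the energy with the coordinate free. *)
Lemma energy_der l1 a l2 f : energy (l1 ++ Der a :: l2) f <=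
  2 * tau ^+ 2 * (energy (l1 ++ Fix a :: l2) f + energy (l1 ++ Free :: l2) f).
Proof.
elim: l1 f => [|[|b|b] l1 IH] f; rewrite ?cat0s ?cat_cons ?cat0s ?cat_cons ?cat0s ?cat_cons.
- rewrite [energy (Der a :: l2) f]/=.
  apply: (@le_trans _ _ (tau ^+ 2 * (2 * energy l2 (fun s => f (a :: s)) + 2 * energy l2 (cons_avg f)))).
    by rewrite ler_wpM2l ?sqr_ge0 // energyB.
  have -> : forall u v : R, tau ^+ 2 * (2 * u + 2 * v) = 2 * tau ^+ 2 * (u + v).
    by move=> u v; ring.
  have t0 : 0 <= 2 * tau ^+ 2 by rewrite pmulr_rge0 ?sqr_ge0.
  rewrite ler_wpM2l //.
  by rewrite [energy (Fix a :: l2) f]/= lerD2l energy_cons_avg.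
- rewrite /=.
  have H : mean (fun b => energy (l1 ++ Der a :: l2) (dev b f)) <= 2 * tau ^+ 2 *
     (mean (fun b => energy (l1 ++ Fix a :: l2) (dev b f)) +
      mean (fun b => energy (l1 ++ Free :: l2) (dev b f))).
    by rewrite -meanD -meanZ; apply: le_mean => b; exact: IH.
  have := ler_wpM2l theta0 H; have := IH (cons_avg f); lra.
- exact: IH.
- rewrite /=; have := ler_wpM2l (sqr_ge0 tau) (IH (dev b f)); lra.
Qed.

(** Derivatives are traded for restrictions one coordinate at a time; each trade costs
    [2 * tau ^+ 2 * (L ^+ 2 + 1)], which is at most 1. *)
Lemma energy_der_le (L M : R) n f : 1 <= L -> 0 <= M -> 4 * tau ^+ 2 * L ^+ 2 <= 1 ->
  (forall p, size p = n -> energy (map fix_letter p) f <= M * L ^+ (2 * nfix p)) ->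
  forall p, size p = n -> energy (map der_letter p) f <= M.
Proof.
move=> L1 M0 tL HM.
(* The coordinates of [p] are already traded, those of [q] not yet. *)
suff H q p : (size p + size q)%N = n ->
    energy (map fix_letter p ++ map der_letter q) f <= M * L ^+ (2 * nfix p).
  by move=> p pn; have := H p [::]; rewrite /= add0n => /(_ pn); rewrite mulr1.
elim: q p => [|[a|] q IH] p /= pq.
- by rewrite cats0; apply: HM; rewrite addn0 in pq.
- apply: le_trans (energy_der _ _ _ _) _.
  have HF := IH (rcons p (Some a)); have HN := IH (rcons p None).
  rewrite map_rcons cat_rcons size_rcons in HF.
  rewrite map_rcons cat_rcons size_rcons in HN.
  rewrite -addSnnS in pq.
  move/(_ pq): HF; move/(_ pq): HN.
  have -> : nfix (rcons p (Some a)) = (nfix p).+1.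
    by rewrite /nfix -cats1 count_cat addn1.
  have -> : nfix (rcons p None) = nfix p by rewrite /nfix -cats1 count_cat addn0.
  rewrite mulnS exprD /=.
  set X := L ^+ (2 * nfix p); set e1 := energy _ _; set e2 := energy _ _ => h1 h2.
  have X0 : 0 <= M * X by rewrite mulr_ge0 // exprn_ge0 // (le_trans ler01).
  have L2 : 1 <= L ^+ 2 by rewrite exprn_ege1.
  have h3 : M * X <= L ^+ 2 * (M * X) by rewrite ler_peMl.
  have h4 : e2 + e1 <= 2 * L ^+ 2 * (M * X).
    have -> : 2 * L ^+ 2 * (M * X) = M * (L ^+ 2 * X) + L ^+ 2 * (M * X) by ring.
    by apply: lerD => //; apply: le_trans h1 h3.
  have t0 : 0 <= 2 * tau ^+ 2 by rewrite pmulr_rge0 ?sqr_ge0.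
  apply: le_trans (ler_wpM2l t0 h4) _.
  have -> : 2 * tau ^+ 2 * (2 * L ^+ 2 * (M * X)) = 4 * tau ^+ 2 * L ^+ 2 * (M * X) by ring.
  by rewrite ler_piMl.
- have := IH (rcons p None); rewrite map_rcons cat_rcons size_rcons; rewrite -addSnnS in pq.
  by move/(_ pq); rewrite /nfix -cats1 count_cat addn0.
Qed.

Lemma deriv_energy_ge0 q f : 0 <= deriv_energy q f.
Proof.
by elim: q f => [|[a|] q IH] f /=; rewrite ?sqr_ge0 ?addr_ge0 ?mean_ge0.
Qed.

Lemma total_energy_ge0 n f : 0 <= total_energy n f.
Proof.
by elim: n f => [|n IH] f /=; rewrite ?sqr_ge0 // addr_ge0 // mulr_ge0 // mean_ge0.
Qed.

Lemma cons_avgZ c f : cons_avg (fun s => c * f s) = fun s => c * cons_avg f s.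
Proof. by apply: functional_extensionality => s; rewrite /cons_avg meanZ. Qed.

Lemma devZ a c f : dev a (fun s => c * f s) = fun s => c * dev a f s.
Proof. by apply: functional_extensionality => s; rewrite /dev cons_avgZ mulrBr. Qed.

Lemma deriv_energyZ q c f : deriv_energy q (fun s => c * f s) = c ^+ 2 * deriv_energy q f.
Proof.
elim: q f => [|[a|] q IH] f /=; rewrite ?exprMn ?cons_avgZ ?devZ ?IH //.
rewrite mulrDr; congr (_ + _); rewrite -meanZ.
by apply: eq_mean => a; rewrite devZ IH.
Qed.

Lemma total_energyZ n c f : total_energy n (fun s => c * f s) = c ^+ 2 * total_energy n f.
Proof.
elim: n f => [|n IH] f /=; rewrite ?exprMn ?cons_avgZ ?IH //.
rewrite mulrDr; congr (_ + _); rewrite [RHS]mulrCA -(meanZ (c ^+ 2)); congr (_ * _).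
by apply: eq_mean => a; rewrite devZ IH.
Qed.

(** Noise multiplies each deviation by [tau]: this matches the factor in [energy] at a derivative,
    and [tau ^+ 2 <= theta] handles a free coordinate. *)
Lemma deriv_energy_noise q f : tau ^+ 2 <= theta ->
  deriv_energy q (noise tau (size q) f) <= energy (map der_letter q) f.
Proof.
move=> tt; elim: q f => [|[a|] q IH] f //.
  rewrite [size _]/= [energy _ _]/= [deriv_energy _ _]/=.
  by rewrite (dev_noise x0) deriv_energyZ ler_wpM2l ?sqr_ge0.
rewrite [size _]/= [energy _ _]/= [deriv_energy _ _]/=.
rewrite (cons_avg_noise x0) lerD //.
rewrite (eq_mean (h := fun a => tau ^+ 2 * deriv_energy q (noise tau (size q) (dev a f)))).
  rewrite meanZ; apply: ler_pM; rewrite ?sqr_ge0 //; last by apply: le_mean.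
  by apply: mean_ge0 => a; exact: deriv_energy_ge0.
by move=> a; rewrite (dev_noise x0) deriv_energyZ.
Qed.

Lemma total_energy_noise n f : 2 * tau ^+ 2 <= theta ->
  total_energy n (noise tau n f) <= energy (nseq n Free) f.
Proof.
move=> tt; elim: n f => [|n IH] f //.
rewrite [nseq _ _]/= [energy _ _]/= [total_energy _ _]/=.
rewrite (cons_avg_noise x0) lerD //.
rewrite (eq_mean (h := fun a => tau ^+ 2 * total_energy n (noise tau n (dev a f)))).
  rewrite meanZ mulrA; apply: ler_pM => //; last by apply: le_mean.
    by rewrite pmulr_rge0 ?sqr_ge0.
  by apply: mean_ge0 => a; exact: total_energy_ge0.
by move=> a; rewrite (dev_noise x0) total_energyZ.
Qed.

Lemma energy_corr n f : energy (nseq n Free) f = corr theta n f f.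
Proof.
elim: n f => [|n IH] f; first by rewrite /corr /avg /= expr2.
rewrite (corrS x0) /= IH; congr (_ + _ * _).
by apply: eq_mean => a; rewrite IH.
Qed.

Lemma energy_fill p f :
  energy (map fix_letter p) f = energy (nseq (nfree p) Free) (fun y => f (fill x0 p y)).
Proof.
elim: p f => [|[a|] p IH] f /=; [by [] | by rewrite IH |].
rewrite IH; congr (_ + _ * _); apply: eq_mean => a; exact: IH.
Qed.

End Energy.

(** * The self-improving energy estimate *)

Section EnergyBound.
Variables (R : realFieldType) (T : finType) (x0 : T).
Implicit Types (f g : seq T -> R) (p q : seq (option T)).

(** [gam] may exceed the mean of [f]: the pattern without fixed coordinates only bounds that mean by
    [gam]. *)
Definition spread n (L gam : R) f :=
  forall q, size q = n -> pavg q f <= gam * L ^+ nfix q.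

Lemma spread_fill p n L gam f : size p = n -> spread n L gam f ->
  spread (nfree p) L (gam * L ^+ nfix p) (fun y => f (fill x0 p y)).
Proof.
move=> pn H q qp; rewrite (pavg_fill x0 f qp) -mulrA -exprD -(nfix_combine qp).
by apply: H; rewrite size_combine.
Qed.

(** Hoelder's inequality without roots: average, with weight [f], the tangent bound for [g] at the
    point [c = X / gam]. *)
Lemma avg_power_le n k (gam : R) f g : 0 < gam ->
  (forall s, size s = n -> 0 <= f s <= 1) -> avg n f <= gam ->
  (avg n (fun s => f s * g s)) ^+ (2 * k.+1) <=
    gam ^+ (2 * k).+1 * avg n (fun s => g s ^+ (2 * k.+1)).
Proof.
move=> g0 f01 fg; set X := avg n _; pose c := X / gam.
have E : (2 * k.+1)%N = (2 * k).+2 by rewrite mulnS.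
have fn w : matches (nseq n None) w -> 0 <= f w <= 1.
  by rewrite matches_nseq => /eqP; exact: f01.
have H1 : avg n (fun s => f s * g s ^+ (2 * k.+1)) <= avg n (fun s => g s ^+ (2 * k.+1)).
  by apply: le_pavg => w /fn /andP[_ f1]; rewrite ler_piMl // exprM exprn_ge0 // sqr_ge0.
have H2 : c ^+ (2 * k.+1) * gam <= avg n (fun s => f s * g s ^+ (2 * k.+1)).
  apply: (@le_trans _ _ (avg n (fun s => (c ^+ (2 * k.+1) - (2 * k.+1)%:R * c ^+ (2 * k.+1)) * f s
      + ((2 * k.+1)%:R * c ^+ (2 * k).+1) * (f s * g s)))); last first.
    apply: le_pavg => w /fn /andP[f0 _].
    have := ler_wpM2l f0 (tangent_even_pow (g w) c k).
    apply: le_trans; rewrite le_eqVlt; apply/orP; left; apply/eqP.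
    by rewrite E [c ^+ (2 * k).+2]exprSr; ring.
  rewrite /avg pavgD !pavgZ -/(avg n f) -/(avg n (fun s => f s * g s)) -/X.
  have -> : X = c * gam by rewrite /c divfK // gt_eqF.
  have K1 : (1 : R) <= (2 * k.+1)%:R by rewrite ler1n.
  have c0 : 0 <= c ^+ (2 * k.+1) by rewrite exprM exprn_ge0 // sqr_ge0.
  have -> : (2 * k.+1)%:R * c ^+ (2 * k).+1 * (c * gam) = (2 * k.+1)%:R * c ^+ (2 * k.+1) * gam.
    by rewrite E [c ^+ (2 * k).+2]exprSr; ring.
  have : 0 <= ((2 * k.+1)%:R - 1) * c ^+ (2 * k.+1) * (gam - avg n f).
    by rewrite mulr_ge0 ?subr_ge0 // mulr_ge0 // subr_ge0.
  lra.
have gp : 0 <= gam ^+ (2 * k).+1 by rewrite exprn_ge0 // ltW.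
have := ler_wpM2l gp (le_trans H2 H1); apply: le_trans.
rewrite le_eqVlt; apply/orP; left; apply/eqP.
have -> : X = c * gam by rewrite /c divfK // gt_eqF.
by rewrite exprMn E [gam ^+ (2 * k).+2]exprSr; ring.
Qed.

(* If the bound fails for [f] but holds for its proper restrictions, then the
   energies of all restrictions are controlled by that of [f], and the moment
   estimate for [f] improves its own energy bound. *)
Lemma energy_bound k rho :
  0 < rho <= 1 ->
  (forall A B c : R, 0 <= A -> 0 <= B -> c ^+ 2 <= A * B ->
  (A + 2 * rho * c + rho ^+ 2 * B) ^+ k.+1 <=
    A ^+ k.+1 + 2 * k.+1%:R * rho * c * A ^+ k + (A ^+ k * B + B ^+ k.+1)) ->
  forall (L K : R) n (gam : R) f, 1 <= L -> 0 <= K -> 0 < gam -> 1 <= K ^+ k.+1 * gam ->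
  (forall s, size s = n -> 0 <= f s <= 1) -> spread n L gam f ->
  corr (rho ^+ 2 / (2 * L)) n f f <= K * gam ^+ 2.
Proof.
move=> /andP[rho0 rho1] H1 L K n gam f L1 K0.
have L0 : 0 < L by apply: lt_le_trans L1.
(* As [theta = rho * tau], the noise splits: [rho] goes to hypercontractivity, and [tau] is small
   enough to trade derivatives for restrictions. *)
pose tau := rho / (2 * L); set theta := rho ^+ 2 / (2 * L).
have thE : theta = rho * tau by rewrite /theta /tau mulrA expr2.
have tau0 : 0 < tau by rewrite divr_gt0 ?mulr_gt0.
have theta0 : 0 <= theta by rewrite thE ltW // mulr_gt0.
have tL : 4 * tau ^+ 2 * L ^+ 2 <= 1.
  have -> : 4 * tau ^+ 2 * L ^+ 2 = rho ^+ 2.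
    by rewrite /tau; field; rewrite gt_eqF.
  by rewrite expr_le1 // ltW.
have tr : tau <= rho / 2.
  rewrite /tau ler_pM2l // lef_pV2 ?posrE ?mulr_gt0 // ler_peMr //; lra.
have tt : 2 * tau ^+ 2 <= theta.
  have := ler_wpM2r (ltW tau0) tr; rewrite thE expr2; lra.
have tt1 : tau ^+ 2 <= theta by have := sqr_ge0 tau; lra.
have [N] := ubnP n; elim: N n gam f => // N IH n gam f nN gam0 Kg f01 Hs.
case: (lerP (corr theta n f f) (K * gam ^+ 2)) => // big.
set V := corr theta n f f in big *.
have V0 : 0 < V by apply: le_lt_trans big; rewrite mulr_ge0 // sqr_ge0.
have sub p : size p = n ->
    energy theta tau (map (@fix_letter T) p) f <= V * L ^+ (2 * nfix p).
  move=> pn; rewrite (energy_fill x0) (energy_corr x0).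
  (* With nothing fixed the restriction is [f] itself. Otherwise it has fewer free coordinates and
     is spread with [gam * L ^+ nfix p], so the induction hypothesis applies. *)
  case: (posnP (nfix p)) => [p0|p0].
    have E : p = nseq n None.
      rewrite -pn; move: p0; rewrite /nfix; clear.
      by elim: p => [|[a|] p IH] //= p0; rewrite -IH.
    have F1 : nfree p = n by have := nfix_nfree p; rewrite p0 add0n pn.
    have F2 m (h : seq T -> R) : corr theta m (fun y => h (fill x0 (nseq m None) y))
        (fun y => h (fill x0 (nseq m None) y)) = corr theta m h h.
      elim: m h => [|m IHm] h; first by rewrite /corr /avg.
      rewrite !(corrS x0) -(IHm (cons_avg h)); congr (_ + _ * _).
      by apply: eq_mean => a; rewrite -(IHm (dev a h)).
    by rewrite F1 p0 muln0 mulr1 E F2.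
  have pf := nfix_nfree p.
  apply: le_trans (_ : K * (gam * L ^+ nfix p) ^+ 2 <= _).
    apply: IH.
    - by rewrite ltnS in nN; apply: leq_trans nN; rewrite -pn -pf -[X in (X < _)%N]add0n ltn_add2r.
    - by rewrite mulr_gt0 // exprn_gt0.
    - rewrite mulrA; apply: le_trans Kg _; rewrite ler_peMr ?exprn_ege1 //.
      by rewrite mulr_ge0 ?exprn_ge0 // ltW.
    - move=> s sp; apply: f01; rewrite -pn; exact/matches_size/matches_fill.
    - exact: spread_fill pn Hs.
  rewrite exprMn mulrA -exprM mulnC; apply: ler_wpM2r; last exact: ltW.
  by rewrite exprn_ge0 // ltW.
have HC := @hypercontractive R T x0 k rho H1 n unit (fun=> 1) (fun=> noise tau n f) V.
have {HC} : avg n (fun s => noise theta n f s ^+ (2 * k.+1)) <= V ^+ k * V.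
  have E (G : R) : \sum_(j : unit) 1 * G = G by rewrite sumr_const card_unit mul1r.
  have -> : (fun s => noise theta n f s ^+ (2 * k.+1)) = 
     (fun s => (\sum_(j : unit) 1 * noise rho n (noise tau n f) s ^+ 2) ^+ k.+1).
    by apply: functional_extensionality => s; rewrite E (noise_comp x0) -thE exprM.
  apply: le_trans (HC _ _) _ => //.
    move=> q qn; rewrite E -qn.
    apply: le_trans (deriv_energy_noise x0 q f tt1) _.
    by apply: (energy_der_le theta0 L1 (ltW V0) tL sub).
  rewrite E; apply: ler_wpM2l; first by rewrite exprn_ge0 // ltW.
  by apply: le_trans (total_energy_noise x0 n f tt) _; rewrite (energy_corr x0).
move=> HC.
have Ef : avg n f <= gam.
  have := Hs (nseq n None) (size_nseq _ _).
  by rewrite /nfix count_nseq mul0n mulr1.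
have gp : 0 <= gam ^+ (2 * k).+1 by rewrite exprn_ge0 // ltW.
have := le_trans (avg_power_le k (noise theta n f) gam0 f01 Ef) (ler_wpM2l gp HC).
rewrite -/(corr theta n f f) -/V -exprSr.
have -> : (2 * k.+1)%N = (k.+1 + k.+1)%N by rewrite mul2n addnn.
rewrite exprD ler_pM2r ?exprn_gt0 //.
(* Now [V ^+ k.+1 <= gam ^+ (2 * k).+1], which contradicts [V > K * gam ^+ 2] because
   [K ^+ k.+1 * gam >= 1]. *)
move=> Vg.
have : (K * gam ^+ 2) ^+ k.+1 < V ^+ k.+1.
  by rewrite ltrXn2r // mulr_ge0 // sqr_ge0.
rewrite exprMn -exprM => H2.
have := lt_le_trans H2 Vg.
have -> : (2 * k.+1)%N = (1 + (2 * k).+1)%N by rewrite mulnS.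
rewrite exprD expr1 mulrA gtr_pMl ?exprn_gt0 //.
by rewrite ltNge Kg.
Qed.

End EnergyBound.

(** * Pairs of words that differ everywhere *)

Section EverywhereDifferent.
Variables (R : realFieldType) (T : finType) (x0 : T).
Implicit Types (f g : seq T -> R) (p q : seq (option T)) (s y : seq T).

Lemma ler_norm_mean (g : T -> R) : `|mean g| <= mean (fun a => `|g a|).
Proof.
rewrite ler_norml -mulN1r -meanZ; apply/andP; split; apply: le_mean => a.
  by rewrite mulN1r lerNl -normrN ler_norm.
exact: ler_norm.
Qed.

Lemma mean_gt0 (g : T -> R) : 0 < mean g -> exists a, 0 < g a.
Proof.
case: (boolP [exists a, 0 < g a]) => [/existsP//|/existsPn g0].
suff : mean g <= 0 by rewrite leNgt => /negP.
rewrite -(mean_const x0 0); apply: le_mean => a; rewrite leNgt; exact: g0.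
Qed.

Lemma pavg_gt0 p f : 0 < pavg p f -> exists2 w, matches p w & 0 < f w.
Proof.
elim: p f => [|[a|] p IH] f /=; first by exists [::].
  by move=> /IH[w pw fw]; exists (a :: w); rewrite //= eqxx.
by move=> /mean_gt0[a /IH[w pw fw]]; exists (a :: w).
Qed.

(** The inequality of arithmetic and geometric means at every leaf of the recursion; the weight [t]
    is there to balance families of different density. *)
Lemma norm_corr_le r theta t n f g : `|r| <= theta -> 0 < t ->
  2 * `|corr r n f g| <= t * corr theta n f f + t^-1 * corr theta n g g.
Proof.
move=> rt t0; have th0 : 0 <= theta by apply: le_trans rt.
elim: n f g => [|n IH] f g.
  rewrite /corr /avg /=; set a := f [::]; set b := g [::].
  have H c : 0 <= t^-1 * (t * a + c * b) ^+ 2 by rewrite mulr_ge0 ?sqr_ge0 // invr_ge0 ltW.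
  have E c : t^-1 * (t * a + c * b) ^+ 2 = t * (a * a) + 2 * c * (a * b) + c ^+ 2 * (t^-1 * (b * b)).
    by field; rewrite gt_eqF.
  have := H 1; have := H (-1); rewrite !E => h1 h2.
  case: (lerP 0 (a * b)) => ab; rewrite ?(ger0_norm ab) ?(ltr0_norm ab); lra.
rewrite !(corrS x0).
set v := mean _; set vf := mean (fun a => corr _ _ (dev a f) (dev a f)).
set vg := mean (fun a => corr _ _ (dev a g) (dev a g)).
have Hv : 2 * `|v| <= t * vf + t^-1 * vg.
  apply: (@le_trans _ _ (2 * mean (fun a => `|corr r n (dev a f) (dev a g)|))).
    by rewrite ler_pM2l // ler_norm_mean.
  by rewrite /vf /vg -!meanZ -meanD; apply: le_mean => a; exact: IH.
have Hrv : 2 * `|r * v| <= theta * (t * vf + t^-1 * vg).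
  by rewrite normrM mulrCA; apply: ler_pM => //; rewrite mulr_ge0.
have := IH (cons_avg f) (cons_avg g).
have := ler_normD (corr r n (cons_avg f) (cons_avg g)) (r * v); lra.
Qed.

(** Subtracting the product of the means removes the only part without deviations. Every other part
    has a factor [r]; bounding all but one of these by [theta] saves the ratio [|r| / theta]. *)
Lemma corr_sub_avg_le r theta t n f g : `|r| <= theta -> 0 < t ->
  2 * theta * `|corr r n f g - avg n f * avg n g| <=
  `|r| * (t * corr theta n f f + t^-1 * corr theta n g g).
Proof.
move=> rt t0; have th0 : 0 <= theta by apply: le_trans rt.
elim: n f g => [|n IH] f g.
  rewrite /corr /avg /= subrr normr0 mulr0 mulr_ge0 //.
  have a2 : 0 <= f [::] * f [::] by rewrite -expr2 sqr_ge0.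
  have b2 : 0 <= g [::] * g [::] by rewrite -expr2 sqr_ge0.
  by rewrite addr_ge0 // mulr_ge0 ?invr_ge0 // ltW.
rewrite !(corrS x0) !avgS.
set v := mean _; set vf := mean (fun a => corr _ _ (dev a f) (dev a f)).
set vg := mean (fun a => corr _ _ (dev a g) (dev a g)).
have Hv : 2 * `|v| <= t * vf + t^-1 * vg.
  apply: (@le_trans _ _ (2 * mean (fun a => `|corr r n (dev a f) (dev a g)|))).
    by rewrite ler_pM2l // ler_norm_mean.
  by rewrite /vf /vg -!meanZ -meanD; apply: le_mean => a; exact: norm_corr_le.
have Hrv : 2 * theta * `|r * v| <= `|r| * theta * (t * vf + t^-1 * vg).
  have -> : 2 * theta * `|r * v| = `|r| * theta * (2 * `|v|) by rewrite normrM; ring.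
  by rewrite ler_wpM2l // mulr_ge0.
have := IH (cons_avg f) (cons_avg g).
set c := corr r n _ _; set d := _ * avg n _.
have : `|c + r * v - d| <= `|c - d| + `|r * v| by rewrite addrAC ler_normD.
move=> h1; have := ler_wpM2l (mulr_ge0 (ler0n R 2) th0) h1; lra.
Qed.

(* At this value of [r], [noise r] averages, in each coordinate, over the
   letters different from the given one. *)
Lemma noise_neg_gt0 n g s : (1 < #|T|)%N -> (forall y, size y = n -> 0 <= g y) ->
  size s = n -> 0 < noise (- (#|T|%:R - 1)^-1) n g s ->
  exists y, [/\ size y = n, 0 < g y & all2 (fun a b => a != b) s y].
Proof.
move=> m1; set r := - _; elim: n g s => [|n IH] g s g0.
  by move=> /size0nil ->; exists [::].
case: s => [|a s] //= [sn] H.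
have m1' : 0 < #|T|%:R - 1 :> R by rewrite subr_gt0 ltr1n.
have mP := cardT_gt0 R x0.
have E y : cons_avg g y + r * dev a g y = (#|T|%:R - 1)^-1 * \sum_(b | b != a) g (b :: y).
  rewrite /dev /cons_avg /mean (bigD1 a) //= /r.
  set S := \sum_(b | b != a) _; field.
  by rewrite !gt_eqF.
have h0 y : size y = n -> 0 <= cons_avg g y + r * dev a g y.
  move=> yn; rewrite E; apply: mulr_ge0; first by rewrite invr_ge0 ltW.
  apply: sumr_ge0 => b _.
  by apply: g0; rewrite /= yn.
have [y [yn hy sy]] := IH _ _ h0 sn H.
rewrite E pmulr_rgt0 ?invr_gt0 // in hy.
case: (boolP [exists b, (b != a) && (0 < g (b :: y))]) => [/existsP[b /andP[ba gb]]|/existsPn nb].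
  by exists (b :: y); rewrite /= yn sy eq_sym ba.
suff : \sum_(b | b != a) g (b :: y) <= 0 by rewrite leNgt hy.
apply: sumr_le0 => b ba; rewrite leNgt.
by have := nb b; rewrite ba.
Qed.

End EverywhereDifferent.

(** For [m = #|T|] and [r = -1/(m-1)], [corr] is the mean of [f1 x * f2 y] over pairs that differ
    everywhere. Its distance from the product of the means is at most
    [K * gam1 * gam2 / (theta * (m-1))], which the last hypothesis makes smaller than that
    product. *)
Theorem everywhere_different_pair (R : realFieldType) k : exists C : nat,
  forall (T : finType) (x0 : T) n (f1 f2 : seq T -> R) (L K gam1 gam2 : R),
  1 <= L -> 1 <= K -> 0 < gam1 -> 0 < gam2 ->
  1 <= K ^+ k.+1 * gam1 -> 1 <= K ^+ k.+1 * gam2 ->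
  (forall s, size s = n -> 0 <= f1 s <= 1) -> (forall s, size s = n -> 0 <= f2 s <= 1) ->
  spread n L gam1 f1 -> spread n L gam2 f2 ->
  C%:R * L * K * (gam1 * gam2) < (#|T|%:R - 1) * (avg n f1 * avg n f2) ->
  exists y1 y2, [/\ size y1 = n, size y2 = n, 0 < f1 y1, 0 < f2 y2
    & all2 (fun a b => a != b) y1 y2].
Proof.
have [C C0 H1] := @one_dim_pow R k.
(* This constant times [L] is [theta^-1], for the parameter [theta] of [energy_bound] at
   [rho = C%:R^-1]. *)
exists (2 * C ^ 2)%N => T x0 n f1 f2 L K gam1 gam2 L1 K1 g1 g2 Kg1 Kg2 f1b f2b s1 s2 big.
have L0 : 0 < L by apply: lt_le_trans L1.
have K0 : 0 < K by apply: lt_le_trans K1.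
pose rho : R := C%:R^-1.
have CP : 0 < C%:R :> R by rewrite ltr0n.
have rho01 : 0 < rho <= 1.
  by rewrite /rho invr_gt0 CP invf_le1 // ler1n.
have V1 := energy_bound x0 rho01 H1 L1 (ltW K0) g1 Kg1 f1b s1.
have V2 := energy_bound x0 rho01 H1 L1 (ltW K0) g2 Kg2 f2b s2.
set theta := rho ^+ 2 / (2 * L) in V1 V2.
have th0 : 0 < theta.
  by case/andP: rho01 => r0 _; rewrite divr_gt0 ?mulr_gt0 ?exprn_gt0.
have avg0 (f : seq T -> R) : (forall s, size s = n -> 0 <= f s <= 1) -> 0 <= avg n f.
  by move=> fb; apply: pavg_ge0 => // w; rewrite matches_nseq => /eqP /fb /andP[].
have avgle (f : seq T -> R) gam : spread n L gam f -> avg n f <= gam.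
  by move=> /(_ (nseq n None) (size_nseq _ _)); rewrite /nfix count_nseq mul0n mulr1.
have m1 := avg0 _ f1b; have m2 := avg0 _ f2b.
have mm : avg n f1 * avg n f2 <= gam1 * gam2 by apply: ler_pM => //; exact: avgle.
set M := #|T|%:R - 1 in big *.
have lhs0 : 0 < (2 * C ^ 2)%:R * L * K * (gam1 * gam2).
  by rewrite !mulr_gt0 // ltr0n muln_gt0 expn_gt0 C0.
have M0 : 0 < M.
  rewrite ltNge; apply/negP => Ml.
  by have := mulr_le0_ge0 Ml (mulr_ge0 m1 m2); rewrite leNgt (lt_trans lhs0 big).
have CE : (2 * C ^ 2)%:R * L = theta^-1.
  rewrite natrM natrX /theta /rho; field.
  by rewrite !gt_eqF.
rewrite CE in big lhs0.
(* The means are at most [gam1] and [gam2], so [big] forces [M >= theta^-1]. *)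
have rle : `|- M^-1| <= theta.
  rewrite normrN ger0_norm; last by rewrite invr_ge0 ltW.
  rewrite -[theta]invrK lef_pV2 ?posrE ?invr_gt0 //.
  have gg : 0 < gam1 * gam2 by rewrite mulr_gt0.
  rewrite -(ler_pM2r gg); apply: le_trans (_ : theta^-1 * K * (gam1 * gam2) <= _).
    by rewrite ler_pM2r // ler_peMr // invr_ge0 ltW.
  by apply: le_trans (ltW big) _; rewrite ler_pM2l.
(* With this weight each of the two energies contributes at most [K * (gam1 * gam2)]. *)
have t0 : 0 < gam2 / gam1 by rewrite divr_gt0.
have := corr_sub_avg_le x0 n f1 f2 rle t0.
have V1' : gam2 / gam1 * corr theta n f1 f1 <= K * (gam1 * gam2).
  have -> : K * (gam1 * gam2) = gam2 / gam1 * (K * gam1 ^+ 2).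
    by field; rewrite gt_eqF.
  by rewrite (ler_pM2l t0).
have V2' : (gam2 / gam1)^-1 * corr theta n f2 f2 <= K * (gam1 * gam2).
  have -> : K * (gam1 * gam2) = (gam2 / gam1)^-1 * (K * gam2 ^+ 2).
    by field; rewrite !gt_eqF.
  by rewrite ler_pM2l ?invr_gt0.
have Mi0 : 0 < M^-1 by rewrite invr_gt0.
rewrite normrN (ger0_norm (ltW Mi0)) => H2.
have H3 : 2 * theta * `|corr (- M^-1) n f1 f2 - avg n f1 * avg n f2| <
     2 * theta * (avg n f1 * avg n f2).
  apply: le_lt_trans H2 _.
  apply: (@le_lt_trans _ _ (M^-1 * (K * (gam1 * gam2) + K * (gam1 * gam2)))).
    by rewrite ler_pM2l // lerD.
  have -> : 2 * theta * (avg n f1 * avg n f2) =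
     2 * theta * M^-1 * (M * (avg n f1 * avg n f2)) by field; rewrite gt_eqF.
  have -> : M^-1 * (K * (gam1 * gam2) + K * (gam1 * gam2)) =
     2 * theta * M^-1 * (theta^-1 * K * (gam1 * gam2)) by field; rewrite !gt_eqF.
  have P : 0 < 2 * theta * M^-1 by rewrite mulr_gt0 // mulr_gt0.
  by rewrite (ltr_pM2l P).
have pos : 0 < corr (- M^-1) n f1 f2.
  have P2 : 0 < 2 * theta by rewrite mulr_gt0.
  move: H3; rewrite (ltr_pM2l P2) ltr_norml => /andP[H3 _]; lra.
have [w] := pavg_gt0 x0 pos; rewrite matches_nseq => /eqP wn.
have /andP[f1w _] := f1b w wn => fw.
have f1w' : 0 < f1 w.
  rewrite lt_def f1w andbT; apply: contraTneq fw => ->.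
  by rewrite mul0r ltxx.
rewrite pmulr_rgt0 // in fw.
have T1 : (1 < #|T|)%N by move: M0; rewrite subr_gt0 ltr1n.
have f20 y : size y = n -> 0 <= f2 y by move=> /f2b/andP[].
have [y [yn f2y wy]] := noise_neg_gt0 x0 T1 f20 wn fw.
by exists w, y.
Qed.

(** * Restrictions to subcubes *)

Section Patterns.
Variables (R : realFieldType) (T : finType) (x0 : T).
Implicit Types (f g : seq T -> R) (p q : seq (option T)) (s w : seq T).

Definition upd p i (a : T) := set_nth None p i (Some a).

Definition ext p q := all2 (fun o o' => isSome o ==> (o' == o)) p q.

Lemma extP p q : reflect (size q = size p /\
  forall i, isSome (nth None p i) -> nth None q i = nth None p i) (ext p q).
Proof.
apply: (iffP idP); rewrite /ext.
  elim: p q => [|o p IH] [|o' q] //=.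
  move=> /andP[oo' /IH[-> H]]; split=> // -[|i] //=.
    by move=> so; move: oo'; rewrite so => /eqP.
  exact: H.
elim: p q => [|o p IH] [|o' q] [//= [sz] H]; apply/andP; split.
  by apply/implyP => so; apply/eqP; exact: (H 0%N).
by apply: IH; split=> // i; exact: (H i.+1).
Qed.

Lemma ext_size p q : ext p q -> size q = size p.
Proof. by case/extP. Qed.

Lemma ext_nth p q i a : ext p q -> nth None p i = Some a -> nth None q i = Some a.
Proof. by case/extP => _ H pi; rewrite H pi. Qed.

Lemma ext_refl p : ext p p.
Proof. exact/extP. Qed.

Lemma ext_trans q p r : ext p q -> ext q r -> ext p r.
Proof.
move=> pq qr; apply/extP; split; first by rewrite (ext_size qr) (ext_size pq).
by move=> i; case E: (nth None p i) => [a|] // _; rewrite (ext_nth qr (ext_nth pq E)).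
Qed.

Lemma ext_combine p q : ext p (combine p q).
Proof.
apply/extP; split; first by rewrite size_combine.
by move=> i; case E: (nth None p i) => [a|] // _; exact: nth_combine_fixed.
Qed.

Lemma nfix_card n p : size p = n ->
  nfix p = #|[set i : 'I_n | isSome (nth None p i)]|.
Proof.
move=> <-; rewrite /nfix -sum1_count (big_nth None) big_mkord sum1dep_card.
by apply: eq_card => i; rewrite !inE.
Qed.

Lemma nfix_ext p q : ext p q -> (nfix p <= nfix q)%N.
Proof.
move=> pq; rewrite (nfix_card (ext_size pq)) (nfix_card (erefl (size p))).
apply: subset_leq_card; apply/subsetP => i; rewrite !inE.
by case E: (nth None p i) => [a|] // _; rewrite (ext_nth pq E).
Qed.

Lemma size_upd p i a : (i < size p)%N -> size (upd p i a) = size p.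
Proof. by move=> ip; rewrite size_set_nth; exact/maxn_idPr. Qed.

Lemma nth_upd p i j a : nth None (upd p i a) j = if j == i then Some a else nth None p j.
Proof. by rewrite nth_set_nth. Qed.

Lemma ext_upd p i a : (i < size p)%N -> nth None p i = None -> ext p (upd p i a).
Proof.
move=> ip pi; apply/extP; split; first exact: size_upd.
by move=> j; rewrite nth_upd; case: eqP => [->|//]; rewrite pi.
Qed.

Lemma nfix_upd p i a : (i < size p)%N -> nth None p i = None ->
  nfix (upd p i a) = (nfix p).+1.
Proof.
rewrite /nfix; elim: p i => [|o p IH] [|i] //= ip pi; first by rewrite pi.
by rewrite [count _ _]IH // addnS.
Qed.

Lemma pavg_split p i f : (i < size p)%N -> nth None p i = None ->
  pavg p f = mean (fun a => pavg (upd p i a) f).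
Proof.
elim: p i f => [|o p IH] [|i] f //=; first by move=> _ ->.
move=> ip pi; case: o => [b|] /=; first exact: IH.
rewrite [RHS](_ : _ = mean (fun a => mean (fun b => pavg (upd p i a) (fun s => f (b :: s))))) //.
rewrite (eq_mean (h := fun b => mean (fun a => pavg (upd p i a) (fun s => f (b :: s))))).
  rewrite /mean -!mulr_suml; congr (_ / _ / _); exact: exchange_big.
by move=> b; exact: IH.
Qed.

Lemma pavg_letter p i f (P : {set T}) : (i < size p)%N -> nth None p i = None ->
  pavg p (fun w => f w * (nth x0 w i \in P)%:R) =
  (\sum_(a in P) pavg (upd p i a) f) / #|T|%:R.
Proof.
move=> ip pi; rewrite (pavg_split _ ip pi) /mean; congr (_ / _).
rewrite [RHS]big_mkcond; apply: eq_bigr => a _.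
have E : pavg (upd p i a) (fun w => f w * (nth x0 w i \in P)%:R)
   = pavg (upd p i a) (fun w => (a \in P)%:R * f w).
  apply: eq_pavg => w pw; rewrite (@matches_nth _ x0 _ _ i a pw) 1?mulrC //.
  by rewrite nth_upd eqxx.
by rewrite E pavgZ; case: (a \in P); rewrite ?mul1r ?mul0r.
Qed.

(** Spreadness of the restriction of [f] to [p]; the factor [L ^+ nfix p] replaces a subtraction of
    exponents. *)
Definition pspread (L gam : R) p f :=
  forall q, ext p q -> pavg q f * L ^+ nfix p <= gam * L ^+ nfix q.

Lemma pspread_fill L gam p f : 0 < L -> pspread L gam p f ->
  spread (nfree p) L gam (fun y => f (fill x0 p y)).
Proof.
move=> L0 H q qp; rewrite (pavg_fill x0 f qp).
have := H _ (ext_combine p q); rewrite (nfix_combine qp) exprD mulrCA mulrC.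
by rewrite ler_pM2l // exprn_gt0.
Qed.

Lemma pspread_ext L gam p p' f : 0 < L -> ext p p' -> pspread L gam p f ->
  pspread L (gam * L ^+ (nfix p' - nfix p)) p' f.
Proof.
move=> L0 pp' H q p'q; have LP i : 0 < L ^+ i by rewrite exprn_gt0.
have h := H q (ext_trans pp' p'q).
have -> : L ^+ nfix p' = L ^+ nfix p * L ^+ (nfix p' - nfix p).
  by rewrite -exprD subnKC ?nfix_ext.
by rewrite mulrA [leRHS]mulrAC ler_pM2r.
Qed.

Lemma pspread_base L L' gam p f : 0 < L -> L <= L' -> 0 <= gam ->
  pspread L gam p f -> pspread L' gam p f.
Proof.
move=> L0 LL g0 H q pq; have L'0 : 0 < L' by apply: lt_le_trans LL.
have := H q pq; rewrite -(subnKC (nfix_ext pq)) !exprD.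
rewrite [gam * _]mulrCA [gam * (L' ^+ _ * _)]mulrCA mulrC ler_pM2l ?exprn_gt0 // => h.
rewrite [leLHS]mulrC ler_pM2l ?exprn_gt0 //; apply: le_trans h _.
by rewrite ler_wpM2l // lerXn2r ?nnegrE // ltW.
Qed.

Lemma pspread_le L gam p f g : 0 < L -> (forall w, f w <= g w) ->
  pspread L gam p g -> pspread L gam p f.
Proof.
move=> L0 fg H q pq; apply: le_trans (H q pq).
by rewrite ler_pM2r ?exprn_gt0 // le_pavg.
Qed.

(** Among the finitely many extensions of [p], take one that maximizes [pavg q f / L ^+ nfix q]. *)
Lemma spread_extension L p f : 0 < L -> exists q, [/\ ext p q,
  pavg p f * L ^+ nfix q <= pavg q f * L ^+ nfix p & pspread L (pavg q f) q f].
Proof.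
move=> L0; have LP i : 0 < L ^+ i by rewrite exprn_gt0.
pose F (q : (size p).-tuple (option T)) : R := pavg q f / L ^+ nfix q.
pose q0 := in_tuple p.
case: (@arg_maxP _ R ((size p).-tuple (option T)) q0 (fun t => ext p (tval t)) F (ext_refl p)) => q pq qmax.
have cross q1 q2 : pavg q1 f / L ^+ nfix q1 <= pavg q2 f / L ^+ nfix q2 ->
    pavg q1 f * L ^+ nfix q2 <= pavg q2 f * L ^+ nfix q1.
  by rewrite ler_pdivrMr // mulrAC ler_pdivlMr.
exists q; split => //; first by apply: cross; exact: (qmax q0 (ext_refl p)).
move=> q' qq'.
have sq' : size q' == size p by rewrite (ext_size qq') size_tuple.
apply: cross; exact: (qmax (Tuple sq') (ext_trans pq qq')).
Qed.

(** The coordinates of [G] are fixed in turn, each at a letter where the conditional mean does not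
    drop. *)
Lemma averaging_extension (G : seq nat) p f : (forall i, i \in G -> (i < size p)%N) ->
  exists q, [/\ ext p q, (nfix q <= nfix p + size G)%N, pavg p f <= pavg q f
    & forall i, isSome (nth None q i) = isSome (nth None p i) || (i \in G)].
Proof.
elim: G => [|i G IH] HG.
  by exists p; rewrite addn0; split=> // [|i]; rewrite ?ext_refl ?orbF.
have [j jG|q [pq nq fq sq]] := IH; first by apply: HG; rewrite inE jG orbT.
have ip : (i < size q)%N by rewrite (ext_size pq) HG // inE eqxx.
case E: (nth None q i) => [b|].
  exists q; split=> //; first by rewrite /= addnS ltnW // ltnS.
  move=> j; rewrite sq inE orbCA; case: eqP => // -> /=.
  by rewrite -sq E.
have [a aq] : exists a, pavg q f <= pavg (upd q i a) f.
  case: (boolP [exists a, pavg q f <= pavg (upd q i a) f]) => [/existsP//|/existsPn H].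
  suff : pavg q f < pavg q f by rewrite ltxx.
  rewrite {1}(pavg_split f ip E) -[ltRHS](mean_const x0) /mean.
  rewrite ltr_pM2r ?invr_gt0 ?(cardT_gt0 R x0) //; apply: ltr_sum.
    by apply/hasP; exists x0; rewrite ?mem_index_enum.
  by move=> a _; rewrite ltNge; exact: H.
exists (upd q i a); split.
- exact: ext_trans pq (ext_upd a ip E).
- by rewrite nfix_upd // addnS ltnS.
- exact: le_trans fq aq.
move=> j; rewrite nth_upd inE; case: eqP => [->|_] /=; first by rewrite orbT.
exact: sq.
Qed.

End Patterns.

(** * Letters at free coordinates *)

Section Coordinates.
Variables (R : realFieldType) (T : finType) (x0 : T).
Implicit Types (f g : seq T -> R) (p q : seq (option T)) (s w : seq T) (H : seq nat).

(** Union bound: by spreadness, words with the letter of [p2] at one given coordinate of [D] carry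
    at most the fraction [L / #|T|] of the mean, hence at most half of it over all of [D]. *)
Lemma pavg_avoid_le n p1 p2 L f : size p1 = n -> 0 < L ->
  (forall w, 0 <= f w) -> pspread L (pavg p1 f) p1 f ->
  let D := [set i : 'I_n | ~~ isSome (nth None p1 i) && isSome (nth None p2 i)] in
  2 * #|D|%:R * L <= #|T|%:R ->
  pavg p1 f <= 2 * pavg p1 (fun w =>
    f w * [forall i in D, Some (nth x0 w i) != nth None p2 i]%:R).
Proof.
move=> pn L0 f0 Hs D DL; set mu := pavg p1 f.
have mP := cardT_gt0 R x0.
have mu0 : 0 <= mu by exact: pavg_ge0.
pose hit (i : 'I_n) := [set a | Some a == nth None p2 i].
pose F (i : 'I_n) w := (i \in D)%:R * (f w * (nth x0 w i \in hit i)%:R).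
have FD i : pavg p1 (F i) <= (i \in D)%:R * (mu * L / #|T|%:R).
  rewrite /F pavgZ; case: (boolP (i \in D)) => [iD|_]; last by rewrite !mul0r.
  rewrite !mul1r; move: iD; rewrite inE => /andP[i1 i2].
  have ip : (i < size p1)%N by rewrite pn.
  have E1 : nth None p1 i = None by case: (nth None p1 i) i1.
  rewrite pavg_letter // ler_pM2r ?invr_gt0 //.
  case E2 : (nth None p2 i) i2 => [a|] // _.
  rewrite (big_pred1 a) => [|b]; last by rewrite /hit inE E2.
  have := Hs _ (ext_upd a ip E1).
  by rewrite nfix_upd // exprSr mulrA mulrAC ler_pM2r // exprn_gt0.
have H1 : mu - \sum_i pavg p1 (F i) <= pavg p1 (fun w =>
    f w * [forall i in D, Some (nth x0 w i) != nth None p2 i]%:R).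
  rewrite -pavg_sum -pavgB; apply: le_pavg => w _.
  have F0 i : 0 <= F i w by rewrite !mulr_ge0 ?ler0n.
  case: (boolP [forall i in D, _]) => [_|/forall_inPn[i iD]].
    by rewrite mulr1 gerBl sumr_ge0.
  rewrite negbK => hi; rewrite mulr0 subr_le0 (bigD1 i) //=.
  have hm : nth x0 w i \in hit i by rewrite inE.
  rewrite {1}/F iD hm mul1r mulr1 lerDl sumr_ge0 // => j _; exact: F0.
have H2 : \sum_i pavg p1 (F i) <= mu / 2.
  apply: (@le_trans _ _ (\sum_i (i \in D)%:R * (mu * L / #|T|%:R))).
    by apply: ler_sum => i _; exact: FD.
  rewrite -mulr_suml -natr_sum -big_mkcond /= sum1_card.
  have -> : #|D|%:R * (mu * L / #|T|%:R) = (mu / 2) * ((2 * #|D|%:R * L) / #|T|%:R).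
    by field; rewrite gt_eqF.
  rewrite ler_piMr //; first by rewrite divr_ge0.
  by rewrite ler_pdivrMr // mul1r.
lra.
Qed.

Lemma pavg_letters_le H (P : nat -> {set T}) p : uniq H ->
  (forall i, i \in H -> (i < size p)%N && ~~ isSome (nth None p i)) ->
  (forall i, i \in H -> (2 * #|P i| <= #|T|)%N) ->
  pavg p (fun w => (all (fun i => nth x0 w i \in P i) H)%:R : R) * 2 ^+ size H <= 1.
Proof.
have mP := cardT_gt0 R x0.
elim: H p => [|i H IH] p; first by rewrite expr0 mulr1 /= (pavg_const x0).
rewrite [uniq _]/= [size _]/=.
move=> /andP[iH uH] Hp HP.
have /andP[ip pi] := Hp i (mem_head _ _).
have pN : nth None p i = None by case: (nth None p i) pi.
rewrite (_ : (fun w => _) = (fun w => (all (fun i => nth x0 w i \in P i) H)%:R *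
    (nth x0 w i \in P i)%:R)); last first.
  by apply: functional_extensionality => w; rewrite /= andbC -natrM mulnb.
rewrite pavg_letter // mulrAC ler_pdivrMr // mul1r exprSr mulrA mulr_suml.
apply: (@le_trans _ _ ((\sum_(a in P i) 1) * 2)).
  rewrite ler_pM2r //; apply: ler_sum => a _; apply: IH => //.
    move=> j jH; rewrite size_upd // nth_upd.
    have -> : j == i = false by apply: contraNF iH => /eqP <-.
    by apply: Hp; rewrite inE jH orbT.
  by move=> j jH; apply: HP; rewrite inE jH orbT.
by rewrite sumr_const -natrM ler_nat mulnC HP // mem_head.
Qed.

(** Words with some letter outside the sets [P i] carry at most [mu / (2 * size H)] per coordinate,
    hence at most half of the mean. The other words have density at most [2 ^ -(size H)]. *)
Lemma few_letters_le H (P : nat -> {set T}) p f : uniq H ->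
  (forall i, i \in H -> (i < size p)%N && ~~ isSome (nth None p i)) ->
  (forall i, i \in H -> (2 * #|P i| <= #|T|)%N) ->
  (forall w, 0 <= f w <= 1) ->
  (forall i a, i \in H -> a \notin P i ->
     (2 * size H)%:R * pavg (upd p i a) f <= pavg p f) ->
  pavg p f * 2 ^+ size H <= 2.
Proof.
move=> uH Hp HP f01 Hf; set mu := pavg p f.
have mP := cardT_gt0 R x0.
have mu0 : 0 <= mu by apply: pavg_ge0 => // w _; case/andP: (f01 w).
have all_le := pavg_letters_le uH Hp HP.
set A := pavg p _ in all_le.
case: (posnP (size H)) => [h0|hP].
  rewrite h0 mulr1; apply: (@le_trans _ _ 1); last by rewrite ler1n.
  rewrite -[leRHS](pavg_const x0 p); apply: le_pavg => w _; by case/andP: (f01 w).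
pose F (k : 'I_(size H)) w := f w * (nth x0 w (nth 0%N H k) \in ~: P (nth 0%N H k))%:R.
have kH (k : 'I_(size H)) : nth 0%N H k \in H by exact: mem_nth.
have HR : 0 < (2 * size H)%:R :> R by rewrite ltr0n muln_gt0.
have FB k : pavg p (F k) <= mu / (2 * size H)%:R.
  have /andP[ip pi] := Hp _ (kH k).
  have pN : nth None p (nth 0%N H k) = None by case: (nth None p _) pi.
  rewrite pavg_letter // ler_pdivrMr //.
  apply: (@le_trans _ _ (\sum_(a in ~: P (nth 0%N H k)) mu / (2 * size H)%:R)).
    apply: ler_sum => a; rewrite inE => aP.
    rewrite ler_pdivlMr // mulrC; exact: Hf.
  rewrite sumr_const -(mulr_natr (mu / _)) ler_wpM2l ?divr_ge0 // ?ler_nat ?max_card //.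
have H1 : mu <= A + \sum_k pavg p (F k).
  rewrite -pavg_sum -pavgD; apply: le_pavg => w _.
  have /andP[f0 f1] := f01 w.
  have F0 k : 0 <= F k w by rewrite mulr_ge0 ?ler0n.
  case: (boolP (all _ H)) => [_|/allPn[i iH wi]].
    by rewrite -[leLHS]addr0 lerD // sumr_ge0.
  rewrite add0r; have ki : (index i H < size H)%N by rewrite index_mem.
  rewrite (bigD1 (Ordinal ki)) //= {1}/F /= nth_index // inE wi mulr1.
  by rewrite lerDl sumr_ge0.
have H2 : \sum_k pavg p (F k) <= mu / 2.
  apply: (@le_trans _ _ (\sum_(k < size H) mu / (2 * size H)%:R)).
    by apply: ler_sum => k _; exact: FB.
  rewrite sumr_const card_ord -(mulr_natr (mu / _)) natrM.
  rewrite le_eqVlt; apply/orP; left; apply/eqP; field.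
  by rewrite pnatr_eq0 -lt0n.
have P2 : 0 <= 2 ^+ size H :> R by rewrite exprn_ge0.
have : mu <= 2 * A by lra.
move=> /(ler_wpM2r P2); lra.
Qed.

Lemma isSome_nth p q i : map isSome p = map isSome q ->
  isSome (nth None p i) = isSome (nth None q i).
Proof. by elim: p q i => [|o p IH] [|o' q] [|i] //= [? /IH]. Qed.

Lemma map_isSome_upd p i a : (i < size p)%N ->
  map isSome (upd p i a) = set_nth false (map isSome p) i true.
Proof.
rewrite /upd; elim: p i => [|o p IH] [|i] //= ip; congr cons; exact: IH.
Qed.

Lemma nfree_iota p : nfree p = size [seq i <- iota 0 (size p) | ~~ isSome (nth None p i)].
Proof.
rewrite size_filter -{1}(mkseq_nth None p) /nfree /mkseq count_map.
by apply: eq_count.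
Qed.

(* If no coordinate and letter were good for both families, then at each free
   coordinate one of the two families would essentially use at most half of
   the letters; this happens at [h] coordinates for the same family. *)
Lemma common_letter h p1 p2 f1 f2 : map isSome p1 = map isSome p2 ->
  (2 * h <= nfree p1)%N ->
  (forall w, 0 <= f1 w <= 1) -> (forall w, 0 <= f2 w <= 1) ->
  2 < pavg p1 f1 * 2 ^+ h -> 2 < pavg p2 f2 * 2 ^+ h ->
  exists i a, [/\ (i < size p1)%N, nth None p1 i = None,
    pavg p1 f1 <= (2 * h)%:R * pavg (upd p1 i a) f1 &
    pavg p2 f2 <= (2 * h)%:R * pavg (upd p2 i a) f2].
Proof.
move=> sp hp f1b f2b big1 big2.
pose good p f i := [set a | pavg p f <= (2 * h)%:R * pavg (upd p i a) f].
case: (boolP [exists i : 'I_(size p1), ~~ isSome (nth None p1 i) &&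
   [exists a, (a \in good p1 f1 i) && (a \in good p2 f2 i)]]).
  move=> /existsP[i /andP[pi /existsP[a]]]; rewrite !inE => /andP[a1 a2].
  by exists i, a; split=> //; case: (nth None p1 i) pi.
move=> /existsPn none; exfalso.
have ps : size p2 = size p1 by rewrite -(size_map isSome p1) sp size_map.
pose free := [seq i <- iota 0 (size p1) | ~~ isSome (nth None p1 i)].
have freeP i : i \in free -> (i < size p1)%N && ~~ isSome (nth None p1 i).
  by rewrite mem_filter mem_iota add0n andbC.
have half i : i \in free -> (2 * #|good p1 f1 i| <= #|T|)%N || (2 * #|good p2 f2 i| <= #|T|)%N.
  move=> /freeP/andP[ip pi]; have := none (Ordinal ip); rewrite /= pi /= => /existsPn dis.
  have I0 : good p1 f1 i :&: good p2 f2 i = set0.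
    by apply/setP => a; rewrite [in LHS]inE [RHS]inE; apply: negbTE; exact: dis.
  have : (#|good p1 f1 i| + #|good p2 f2 i| <= #|T|)%N.
    by rewrite -cardsUI I0 cards0 addn0 max_card.
  case: (leqP (2 * #|good p1 f1 i|) #|T|) => //= h1 h2.
  rewrite -(leq_add2l (2 * #|good p1 f1 i|)) -mulnDr.
  by apply: (@leq_trans (2 * #|T|)); [rewrite leq_pmul2l | rewrite mul2n -addnn leq_add2r ltnW].
have contra p f (H : seq nat) : size p = size p1 -> map isSome p1 = map isSome p ->
    (forall w, 0 <= f w <= 1) -> 2 < pavg p f * 2 ^+ h ->
    {subset H <= free} -> uniq H -> (h <= size H)%N ->
    (forall i, i \in H -> (2 * #|good p f i| <= #|T|)%N) -> False.
  move=> sz spp fb big Hf uH hH HP.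
  have sub i : i \in take h H -> i \in H by exact: mem_take.
  (* Exactly [h] coordinates are kept, so that the threshold [2 * size H] agrees with the [2 * h] in
     [good]. *)
  have := @few_letters_le (take h H) (good p f) p f (take_uniq _ uH).
  rewrite size_takel // => /(_ _ _ fb _).
  move=> few; suff : pavg p f * 2 ^+ h <= 2 by rewrite leNgt big.
  apply: few => [i /sub/Hf/freeP|i /sub|i a /sub iH].
  - by rewrite sz (isSome_nth _ spp).
  - exact: HP.
  - by rewrite inE -ltNge => /ltW.
pose F1 := [seq i <- free | (2 * #|good p1 f1 i| <= #|T|)%N].
pose F2 := [seq i <- free | ~~ (2 * #|good p1 f1 i| <= #|T|)%N].
have uf : uniq free by rewrite filter_uniq // iota_uniq.
have szF : (size F1 + size F2)%N = size free.
  by rewrite !(size_filter _ free) -(count_predC (fun i => (2 * #|good p1 f1 i| <= #|T|)%N)); congr addn; apply: eq_count.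
case: (leqP h (size F1)) => [h1|h1].
  apply: (contra p1 f1 F1) => //; rewrite ?(filter_uniq _ uf) //.
    by move=> i; rewrite mem_filter => /andP[].
  by move=> i; rewrite mem_filter => /andP[].
apply: (contra p2 f2 F2) => //; rewrite ?(filter_uniq _ uf) //.
- by move=> i; rewrite mem_filter => /andP[].
- rewrite -(leq_add2l (size F1)) szF -nfree_iota; apply: leq_trans hp.
  by rewrite mul2n -addnn leq_add2r ltnW.
- move=> i; rewrite mem_filter => /andP[n1 /half]; by rewrite (negbTE n1).
Qed.

(** Each use of [common_letter] fixes a common letter and divides the means by at most [2 * h <= l].
    The factor [l%:R ^+ s] in the density hypotheses keeps it applicable [s] times. *)
Lemma agreeing_extension (h l s : nat) p1 p2 f1 f2 : (0 < l)%N -> (2 * h <= l)%N ->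
  map isSome p1 = map isSome p2 -> (2 * h + s <= nfree p1)%N ->
  (forall w, 0 <= f1 w <= 1) -> (forall w, 0 <= f2 w <= 1) ->
  2 * l%:R ^+ s < pavg p1 f1 * 2 ^+ h -> 2 * l%:R ^+ s < pavg p2 f2 * 2 ^+ h ->
  exists q1 q2, [/\ ext p1 q1 /\ ext p2 q2, map isSome q1 = map isSome q2,
    nfix q1 = (nfix p1 + s)%N /\ nfix q2 = (nfix p2 + s)%N,
    pavg p1 f1 <= l%:R ^+ s * pavg q1 f1 /\ pavg p2 f2 <= l%:R ^+ s * pavg q2 f2 &
    forall i, nth None p1 i = None -> nth None q1 i = nth None q2 i].
Proof.
move=> l0 hl; have lP : 0 < l%:R :> R by rewrite ltr0n.
have hlR : (2 * h)%:R <= l%:R :> R by rewrite ler_nat.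
elim: s p1 p2 => [|s IH] p1 p2 sp hp f1b f2b big1 big2.
  exists p1, p2; rewrite !addn0 !expr0 !mul1r; split=> //; first by rewrite !ext_refl.
  move=> i pi; rewrite pi; have := isSome_nth i sp; rewrite pi.
  by case: (nth None p2 i).
have ps : size p2 = size p1 by rewrite -(size_map isSome p1) sp size_map.
have lS : 1 <= l%:R ^+ s.+1 :> R by rewrite exprn_ege1 // ler1n.
have [|||i [a [ip pi g1 g2]]] := @common_letter h p1 p2 f1 f2 sp _ f1b f2b.
- by apply: leq_trans hp; rewrite leq_addr.
- by apply: le_lt_trans big1; rewrite ler_peMr.
- by apply: le_lt_trans big2; rewrite ler_peMr.
have pi2 : nth None p2 i = None.
  by have := isSome_nth i sp; rewrite pi; case: (nth None p2 i).
have ip2 : (i < size p2)%N by rewrite ps.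
have sp' : map isSome (upd p1 i a) = map isSome (upd p2 i a).
  by rewrite !map_isSome_upd ?sp.
have step p f : (forall w, 0 <= f w <= 1) -> pavg p f <= (2 * h)%:R * pavg (upd p i a) f ->
    pavg p f <= l%:R * pavg (upd p i a) f.
  move=> fb g; apply: le_trans g _; rewrite ler_wpM2r // pavg_ge0 // => w _.
  by case/andP: (fb w).
have st1 := step _ _ f1b g1; have st2 := step _ _ f2b g2.
have big p f : pavg p f <= l%:R * pavg (upd p i a) f -> 2 * l%:R ^+ s.+1 < pavg p f * 2 ^+ h ->
    2 * l%:R ^+ s < pavg (upd p i a) f * 2 ^+ h.
  move=> st bg; rewrite -(ltr_pM2l lP) mulrCA -exprS; apply: lt_le_trans bg _.
  by rewrite mulrA ler_pM2r // exprn_gt0.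
have [|q1 [q2 [[e1 e2] sq [n1 n2] [m1 m2] agree]]] :=
   IH _ _ sp' _ f1b f2b (big _ _ st1 big1) (big _ _ st2 big2).
  have := nfix_nfree (upd p1 i a); rewrite size_upd // nfix_upd // -(nfix_nfree p1).
  by rewrite addSnnS => /addnI E; rewrite -ltnS E -addnS.
exists q1, q2; split=> //.
- split; [exact: ext_trans (ext_upd a ip pi) e1|exact: ext_trans (ext_upd a ip2 pi2) e2].
- by rewrite n1 n2 !nfix_upd // !addSnnS.
- split; rewrite exprS -mulrA; [apply: le_trans st1 _ | apply: le_trans st2 _];
    by rewrite ler_pM2l.
move=> j pj; case: (eqVneq j i) => [->|ji].
  have U p : nth None (upd p i a) i = Some a by rewrite nth_upd eqxx.
  by rewrite (ext_nth e1 (U p1)) (ext_nth e2 (U p2)).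
by apply: agree; rewrite nth_upd (negbTE ji).
Qed.

End Coordinates.

(** * Aligned restrictions of the two families *)

Section Alignment.
Variables (R : realFieldType) (T : finType) (x0 : T).
Implicit Types (f g : seq T -> R) (p q : seq (option T)) (s w : seq T).

Lemma nfix_nseq n : nfix (nseq n (@None T)) = 0%N.
Proof. by rewrite /nfix count_nseq mul0n. Qed.

Lemma combine_nseq p : combine p (nseq (nfree p) None) = p.
Proof.
by rewrite /nfree; elim: p => [|[a|] p IH] //=; rewrite ?add0n ?add1n /= IH.
Qed.

Lemma avg_fill p f : avg (nfree p) (fun y => f (fill x0 p y)) = pavg p f.
Proof. by rewrite /avg (pavg_fill x0 f) ?size_nseq // combine_nseq. Qed.

Lemma pavg_le1 p f : (forall w, 0 <= f w <= 1) -> pavg p f <= 1.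
Proof.
by move=> fb; rewrite -[leRHS](pavg_const x0 p); apply: le_pavg => w _; case/andP: (fb w).
Qed.

(** Bounds the number [x] of extra coordinates of the second restriction: the density gain
    [l ^ (e * x)] is at most [l ^ (4 * E * k)]. *)
Lemma aligned_exponent e x k E : (4 * k.+1 <= e)%N -> (e * x <= 4 * E * k)%N -> (x <= E)%N.
Proof. nia. Qed.

(** First [p0] is a densest restriction of [f1] to base [l]; [F2 p0] vanishes on words that agree
    with [p0] outside [G]. Then [p2] is a restriction of [F2 p0], spread to base [l ^ e], that also
    fixes the coordinates of [p0] and [G]. Finally words of [f1] that meet [p2] at a new coordinate
    are discarded, and [p1] extends [p0] to the coordinates of [p2]. *)
Lemma aligned_patterns (l e E k n : nat) (G : {set 'I_n}) f1
    (F2 : seq (option T) -> seq T -> R) (delta : R) :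
  (1 < l)%N -> (4 * k.+1 <= e)%N -> (#|G| <= 2 * k)%N ->
  0 < delta -> 1 <= delta * l%:R ^+ (4 * E * k) ->
  (2 * (E + 2 * k) * l <= #|T|)%N ->
  (forall w, 0 <= f1 w <= 1) -> delta < pavg (nseq n None) f1 ->
  (forall p w, 0 <= F2 p w <= 1) ->
  (forall p (i : 'I_n) w, i \notin G -> nth None p i = Some (nth x0 w i) -> F2 p w = 0) ->
  (forall p, size p = n -> (nfix p <= 4 * E * k)%N -> delta < pavg (nseq n None) (F2 p)) ->
  exists p0 p1 p2 f1' gam,
  [/\ [/\ size p1 = n, map isSome p1 = map isSome p2 & (nfix p1 <= 4 * E * k + 2 * k + E)%N],
    (forall i : 'I_n, i \in G -> isSome (nth None p1 i)) /\
    (forall i : 'I_n, i \notin G -> isSome (nth None p1 i) -> nth None p1 i != nth None p2 i),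
    forall w, 0 <= f1' w <= f1 w,
    [/\ pspread (l%:R ^+ e) gam p1 f1', gam <= l%:R ^+ (E + 2 * k + 1) * pavg p1 f1',
      delta <= gam & delta <= 2 * pavg p1 f1'] &
    pspread (l%:R ^+ e) (pavg p2 (F2 p0)) p2 (F2 p0) /\ delta < pavg p2 (F2 p0)].
Proof.
move=> l1 ek Gk d0 dE lT f1b d1 F2b F2G d2.
have lR : 1 < l%:R :> R by rewrite ltr1n.
have lP : 0 < l%:R :> R by apply: lt_trans lR.
have LP : 0 < l%:R ^+ e :> R by rewrite exprn_gt0.
have size_le j : delta * l%:R ^+ j <= 1 -> (j <= 4 * E * k)%N.
  move=> H; have := le_trans H dE; rewrite ler_pM2l //.
  by rewrite ler_eXn2l.
have f10 w : 0 <= f1 w by case/andP: (f1b w).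
have [p0 [e0 g0 s0]] := spread_extension (nseq n None) f1 lP.
rewrite nfix_nseq mulr1 in g0.
have np0 : (nfix p0 <= 4 * E * k)%N.
  apply: size_le; apply: le_trans (pavg_le1 p0 f1b); apply: le_trans g0.
  by rewrite ler_pM2r ?exprn_gt0 // ltW.
have sz0 : size p0 = n by rewrite (ext_size e0) size_nseq.
set mu := pavg p0 f1 in s0 g0.
have dmu : delta <= mu.
  apply: le_trans (ltW d1) _; apply: le_trans g0.
  by rewrite ler_peMr ?(ltW (lt_trans d0 d1)) // exprn_ege1 // ltW.
pose S0 := [set i : 'I_n | isSome (nth None p0 i)].
have d2' := d2 p0 sz0 np0; set f2 := F2 p0 in d2' *.
have f2b : forall w, 0 <= f2 w <= 1 by move=> w; exact: F2b.
have := @averaging_extension R T x0 [seq val i | i <- enum (S0 :|: G)] (nseq n None) f2.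
case=> [i /mapP[j _ ->]|p20 [e20 n20 g20 sp20]]; first by rewrite size_nseq ltn_ord.
have {}n20 : (nfix p20 <= nfix p0 + 2 * k)%N.
  apply: leq_trans n20 _; rewrite nfix_nseq add0n size_map -cardE.
  apply: leq_trans (leq_card_setU _ _) _.
  by rewrite (nfix_card sz0) leq_add2l.
(* Fixing the coordinates of [p20] lost no density, so each further coordinate must gain a factor
   [l ^ e]; this leaves room for at most [E] of them. *)
have [p2 [e2 g2 s2]] := spread_extension p20 f2 LP.
have sz2 : size p2 = n by rewrite (ext_size e2) (ext_size e20) size_nseq.
have d2f : delta * (l%:R ^+ e) ^+ (nfix p2 - nfix p20) < pavg p2 f2.
  have LPn j : 0 < (l%:R ^+ e) ^+ j :> R by rewrite exprn_gt0.
  have d20 : delta < pavg p20 f2 by apply: lt_le_trans g20.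
  apply: (@lt_le_trans _ _ (pavg p20 f2 * (l%:R ^+ e) ^+ (nfix p2 - nfix p20))).
    by rewrite ltr_pM2r.
  rewrite -(ler_pM2r (LPn (nfix p20))) -mulrA -exprD subnK //; exact: nfix_ext.
have x_le : (nfix p2 - nfix p20 <= E)%N.
  apply: (aligned_exponent ek); apply: size_le.
  by rewrite exprM; apply: le_trans (ltW d2f) _; exact: pavg_le1.
have d2p : delta < pavg p2 f2.
  apply: le_lt_trans d2f; rewrite ler_peMr ?(ltW d0) //.
  by rewrite exprn_ege1 // exprn_ege1 // ltW.
have sub02 (i : 'I_n) : isSome (nth None p0 i) -> isSome (nth None p2 i).
  move=> pi; have : isSome (nth None p20 i).
    rewrite sp20; apply/orP; right; apply/mapP; exists i => //.
    by rewrite mem_enum !inE pi.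
  by case E1: (nth None p20 i) => [a|] // _; rewrite (ext_nth e2 E1).
have subG2 (i : 'I_n) : i \in G -> isSome (nth None p2 i).
  move=> iG; have : isSome (nth None p20 i).
    rewrite sp20; apply/orP; right; apply/mapP; exists i => //.
    by rewrite mem_enum !inE iG orbT.
  by case E1: (nth None p20 i) => [a|] // _; rewrite (ext_nth e2 E1).
pose D := [set i : 'I_n | ~~ isSome (nth None p0 i) && isSome (nth None p2 i)].
have nD : (nfix p0 + #|D| = nfix p2)%N.
  rewrite (nfix_card sz0) (nfix_card sz2).
  rewrite -[RHS](cardsID S0); congr (_ + _)%N; apply: eq_card => i; rewrite !inE.
    by case: (boolP (isSome _)) => [/sub02 ->|]; rewrite ?andbF ?andbT.
  by [].
have Dle : (#|D| <= E + 2 * k)%N by move: (nfix_ext e2) x_le n20 nD; clear; lia.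
have DT : 2 * #|D|%:R * l%:R <= #|T|%:R :> R.
  rewrite -!natrM ler_nat; apply: leq_trans lT.
  by rewrite leq_mul2r leq_mul2l Dle !orbT.
have avoid := pavg_avoid_le x0 sz0 lP f10 s0 DT.
set f1' := (fun w : seq T => _) in avoid.
have f1'b w : 0 <= f1' w <= f1 w.
  by rewrite /f1'; case: [forall i in D, _]; rewrite ?mulr1 ?mulr0 lexx f10.
have f1'0 w : 0 <= f1' w by case/andP: (f1'b w).
have := @averaging_extension R T x0 [seq val i | i <- enum D] p0 f1'.
case=> [i /mapP[j _ ->]|p1 [e1 n1 g1 sp1]]; first by rewrite sz0 ltn_ord.
rewrite size_map -cardE in n1.
have sz1 : size p1 = n by rewrite (ext_size e1).
have sp12 : map isSome p1 = map isSome p2.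
  apply: (@eq_from_nth _ false); rewrite ?size_map ?sz1 ?sz2 // => i ilt.
  rewrite !(nth_map None) ?sz1 ?sz2 // sp1.
  have -> : (i \in [seq val j | j <- enum D]) = (Ordinal ilt \in D).
    apply/mapP/idP => [[j jD ij]|iD].
      by rewrite mem_enum in jD; rewrite (_ : Ordinal ilt = j) //; apply: val_inj.
    by exists (Ordinal ilt); rewrite ?mem_enum.
  rewrite inE /=; case: (boolP (isSome (nth None p0 i))) => //= pi.
  by rewrite (sub02 (Ordinal ilt)).
have mu2 : mu <= 2 * pavg p1 f1'.
  by apply: le_trans avoid _; rewrite ler_pM2l.
have n1D : (nfix p1 - nfix p0 <= E + 2 * k)%N.
  by rewrite leq_subLR; apply: leq_trans n1 _; rewrite leq_add2l.
have mu0 : 0 <= mu by apply: le_trans dmu; exact: ltW.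
(* Spreadness passes from [p0] to [p1] at the price of one [l] per added coordinate. *)
exists p0, p1, p2, f1', (mu * l%:R ^+ (nfix p1 - nfix p0)); split.
- split=> //; apply: leq_trans n1 _; rewrite -addnA [(2 * k + E)%N]addnC; exact: leq_add.
- split=> i iG.
    by rewrite (isSome_nth i sp12) subG2.
  case E1: (nth None p1 i) => [a|] // _.
  apply/eqP => E2.
  (* A letter shared by [p1] and [p2] at a coordinate of [p0] would make [F2 p0] vanish on the
     subcube of [p2]; at a coordinate of [D] it would make [f1'] vanish on that of [p1]. Both means
     are positive. *)
  case: (boolP (isSome (nth None p0 i))) => [pi|pi].
    have E0 : nth None p0 i = Some a.
      by move: pi; case E0 : (nth None p0 i) => [b|] // _; rewrite -(ext_nth e1 E0).
    have [w mw] := pavg_gt0 x0 (lt_trans d0 d2p).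
    by rewrite /f2 (F2G p0 i) ?ltxx // (matches_nth x0 mw (esym E2)).
  have p1f : 0 < pavg p1 f1' by have := lt_le_trans d0 dmu; lra.
  have [w mw] := pavg_gt0 x0 p1f; rewrite /f1'.
  case: (boolP [forall j in D, _]) => [/forall_inP H|]; last by rewrite mulr0 ltxx.
  have iD : i \in D by rewrite inE pi -E2.
  by have := H i iD; rewrite (matches_nth x0 mw E1) -E2 eqxx.
- exact: f1'b.
- have lS j : 1 <= l%:R ^+ j :> R by rewrite exprn_ege1 // ltW.
  split.
  + apply: (@pspread_base _ _ l%:R) => //.
    * by rewrite -[leLHS]expr1 ler_eXn2l //; apply: leq_trans ek.
    * by rewrite mulr_ge0 ?exprn_ge0 // ltW.
    * apply: pspread_ext => //; apply: pspread_le s0 => // w.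
      by case/andP: (f1'b w).
  + apply: (@le_trans _ _ ((2 * pavg p1 f1') * l%:R ^+ (E + 2 * k))).
      apply: ler_pM => //; first by rewrite exprn_ge0 // ltW.
      by rewrite ler_eXn2l.
    rewrite [leRHS](_ : _ = (l%:R * pavg p1 f1') * l%:R ^+ (E + 2 * k)).
      apply: ler_wpM2r; first by rewrite exprn_ge0 // ltW.
      by rewrite ler_wpM2r ?(ler_nat R 2) //; apply: pavg_ge0.
    by rewrite addn1 exprS; ring.
  + by apply: le_trans dmu _; rewrite ler_peMr.
  + exact: le_trans dmu mu2.
by split.
Qed.

End Alignment.

(** * From sets of functions to words *)

Section Measure.
Variables (m n : nat) (x0 : 'I_m).

Lemma sum_tupleS (F : seq 'I_m -> rat) k :
  \sum_(t : k.+1.-tuple 'I_m) F t = \sum_a \sum_(t : k.-tuple 'I_m) F (a :: t).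
Proof.
rewrite pair_bigA /=.
rewrite (reindex (fun p : 'I_m * k.-tuple 'I_m => [tuple of p.1 :: p.2])) //=.
exists (fun t : k.+1.-tuple 'I_m => (thead t, [tuple of behead t])) => [[a t] _|t _] /=.
  by congr pair; apply: val_inj.
by rewrite [t in RHS]tuple_eta.
Qed.

Lemma avg_tuple k (f : seq 'I_m -> rat) :
  avg k f = (\sum_(t : k.-tuple 'I_m) f t) / (m ^ k)%:R.
Proof.
elim: k f => [|k IH] f.
  rewrite /avg /= expn0 divr1 (big_pred1 [tuple]) // => t.
  by apply/esym/eqP; apply: val_inj; rewrite /= (size0nil (size_tuple t)).
have -> : avg k.+1 f = (\sum_a avg k (fun s => f (a :: s))) / m%:R.
  by rewrite /avg /= /mean card_ord.
rewrite sum_tupleS expnS natrM invfM [m%:R^-1 * _]mulrC mulrA.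
by congr (_ / _); rewrite mulr_suml; apply: eq_bigr => a _; exact: IH.
Qed.

Lemma avg_ffun (f : seq 'I_m -> rat) :
  avg n f = (\sum_(x : {ffun 'I_n -> 'I_m}) f (mktuple x)) / (m ^ n)%:R.
Proof.
rewrite avg_tuple; congr (_ / _).
rewrite (reindex (fun x : {ffun 'I_n -> 'I_m} => mktuple x)) //=.
exists (fun t : n.-tuple 'I_m => [ffun i => tnth t i]) => [x _|t _].
  by apply/ffunP => i; rewrite ffunE tnth_mktuple.
by apply: eq_from_tnth => i; rewrite tnth_mktuple ffunE.
Qed.

Variable R : {set 'I_n}.

Definition proj (w : seq 'I_m) : {ffun coords n R -> 'I_m} :=
  [ffun i : coords n R => nth x0 w (nat_of_ord (val i))].

(** Lifts a family to words of full length [n], so that patterns for both families refer to the same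
    coordinates. *)
Definition cylinder (A : {set {ffun coords n R -> 'I_m}}) (w : seq 'I_m) : rat :=
  (proj w \in A)%:R.

Lemma card_fiber (y : {ffun coords n R -> 'I_m}) :
  #|[set x : {ffun 'I_n -> 'I_m} | proj (mktuple x) == y]| =
  (\prod_(i : 'I_n) (if i \in R then m else 1))%N.
Proof.
pose F (i : 'I_n) : pred 'I_m :=
  if @insub _ _ (coords n R) i is Some j then pred1 (y j) else predT.
rewrite (eq_card (B := family F)) => [|x].
  rewrite card_family foldrE big_map big_enum /=; apply: eq_bigr => i _.
  rewrite /F; case: insubP => [j ij _|/negPn ->]; last by rewrite card_ord.
  by rewrite (negbTE ij) card1.
rewrite !inE; apply/eqP/familyP => [xy i|H].
  rewrite /F; case: insubP => [j ij ji|//].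
  by rewrite inE -xy ffunE nth_mktuple ji.
apply/ffunP => j; rewrite ffunE nth_mktuple.
have := H (val j); rewrite /F valK inE => /eqP ->.
by [].
Qed.

(** All fibers of [proj] have the same size [c], so the lift preserves the measure. *)
Lemma avg_cylinder A : avg n (cylinder A) = mu A.
Proof.
rewrite avg_ffun /mu.
set c := (\prod_(i : 'I_n) (if i \in R then m else 1))%N.
have cnt (B : {set {ffun coords n R -> 'I_m}}) :
    #|[set x : {ffun 'I_n -> 'I_m} | proj (mktuple x) \in B]| = (#|B| * c)%N.
  rewrite -sum1_card (partition_big (fun x : {ffun 'I_n -> 'I_m} => proj (mktuple x)) (mem B)) /=.
    rewrite -sum_nat_const; apply: eq_bigr => y yB.
    rewrite /c -(card_fiber y) -sum1_card; apply: eq_bigl => x.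
    rewrite !inE; case: eqP => [->|_]; first by rewrite yB.
    by rewrite andbF.
  by move=> x; rewrite inE.
have mn : (m ^ n)%N = (#|{: {ffun coords n R -> 'I_m}}| * c)%N.
  have := cnt setT; rewrite cardsT => <-.
  rewrite (_ : [set x | _] = setT); first by rewrite cardsT card_ffun !card_ord.
  by apply/setP => x; rewrite !inE.
have mn0 : (m ^ n != 0)%N.
  by rewrite -lt0n expn_gt0; apply/orP; left; apply: leq_ltn_trans (ltn_ord x0).
have -> : \sum_(x : {ffun 'I_n -> 'I_m}) cylinder A (mktuple x) =
    #|[set x : {ffun 'I_n -> 'I_m} | proj (mktuple x) \in A]|%:R.
  rewrite -sum1_card natr_sum [RHS]big_mkcond /=; apply: eq_bigr => x _.
  by rewrite inE /cylinder; case: (_ \in A).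
rewrite cnt mn !natrM; rewrite mn muln_eq0 negb_or in mn0.
case/andP: mn0 => h1 h2; field.
by rewrite !pnatr_eq0 h1 h2.
Qed.

Lemma cylinder_bounds A w : 0 <= cylinder A w <= 1.
Proof. by rewrite /cylinder; case: (_ \in A). Qed.

(** A word outside the union of these dictators differs from [p] at every coordinate that [p] fixes
    outside [R]. *)
Definition clash p : {set coords n R * 'I_m} :=
  [set d | nth None p (nat_of_ord (val d.1)) == Some d.2].

Lemma card_clash p : size p = n -> (#|clash p| <= nfix p)%N.
Proof.
move=> pn; rewrite (nfix_card pn).
rewrite -(@card_in_imset _ _ (fun d : coords n R * 'I_m => val d.1)).
  apply: subset_leq_card; apply/subsetP => i /imsetP[d dc ->].
  by move: dc; rewrite !inE => /eqP ->.
move=> [i a] [j b]; rewrite !inE /= => /eqP ia /eqP jb ij.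
have eij : i = j by apply: val_inj.
by move: ia; rewrite eij jb => -[->].
Qed.

Lemma cylinder_clash A p (i : 'I_n) w : i \notin R -> nth None p i = Some (nth x0 w i) ->
  cylinder (A :\: dict_union (clash p)) w = 0.
Proof.
move=> iR pi; rewrite /cylinder inE.
suff -> : proj w \in dict_union (clash p) by [].
rewrite inE; apply/existsP; exists (Sub i iR, nth x0 w i).
by rewrite inE /= pi eqxx ffunE /= eqxx.
Qed.

End Measure.

(** * Counting the agreements *)

Section Agreement.

Lemma uncapturable_lt (I : finType) (m r : nat) (eps : rat)
    (A : {set {ffun I -> 'I_m}}) (D : {set I * 'I_m}) :
  uncapturable r eps A -> (#|D| <= r)%N -> eps < mu (A :\: dict_union D).
Proof.
by move=> Au Dr; rewrite ltNge; apply/negP => H; apply: Au; exists D.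
Qed.

(** A coordinate fixed by [p1] lies in [R1 :|: R2] or carries different letters; one fixed by [q1]
    but not by [p1] carries a common letter; at a free one [y1] and [y2] differ. *)
Lemma agree_set_card (m n : nat) (x0 : 'I_m) (R1 R2 : {set 'I_n}) p1 p2 q1 q2 y1 y2 :
  size p1 = n -> ext p1 q1 -> ext p2 q2 -> map isSome p1 = map isSome p2 ->
  map isSome q1 = map isSome q2 ->
  (forall i : 'I_n, i \in R1 :|: R2 -> isSome (nth None p1 i)) ->
  (forall i : 'I_n, i \notin R1 :|: R2 -> isSome (nth None p1 i) ->
     nth None p1 i != nth None p2 i) ->
  (forall i, nth None p1 i = None -> nth None q1 i = nth None q2 i) ->
  size y1 = nfree q1 -> size y2 = nfree q2 -> all2 (fun a b => a != b) y1 y2 ->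
  (#|agree_set (proj x0 R1 (fill x0 q1 y1)) (proj x0 R2 (fill x0 q2 y2))|
    = nfix q1 - nfix p1)%N.
Proof.
move=> p1n e1 e2 sp sq inG outG agr s1 s2 y12.
have q1n : size q1 = n by rewrite (ext_size e1).
have mt1 := matches_fill x0 s1; have mt2 := matches_fill x0 s2.
pose Q := [set i : 'I_n | isSome (nth None q1 i)].
pose P := [set i : 'I_n | isSome (nth None p1 i)].
have PQ : P \subset Q.
  apply/subsetP => i; rewrite !inE.
  by case E: (nth None p1 i) => [a|] // _; rewrite (ext_nth e1 E).
have -> : agree_set (proj x0 R1 (fill x0 q1 y1)) (proj x0 R2 (fill x0 q2 y2)) = Q :\: P.
  apply/setP => i; rewrite !inE.
  case: (boolP (i \in R1 :|: R2)) => [iG|iG].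
    rewrite inG //=; move: iG; rewrite inE.
    case: insubP => [j1 j1R _|//]; case: insubP => [j2 j2R _|//].
    by rewrite (negbTE j1R) (negbTE j2R).
  move: (iG); rewrite inE negb_or => /andP[iR1 iR2].
  rewrite (insubT (fun j => j \notin R1) iR1) (insubT (fun j => j \notin R2) iR2).
  rewrite !ffunE /=.
  case E1: (nth None p1 i) => [a|] /=.
    have := outG i iG; rewrite E1 => /(_ isT).
    have := isSome_nth i sp; rewrite E1; case E2: (nth None p2 i) => [b|] // _.
    rewrite (matches_nth x0 mt1 (ext_nth e1 E1)) (matches_nth x0 mt2 (ext_nth e2 E2)).
    by apply: contraNF => /eqP ->.
  have := agr i E1; case F1: (nth None q1 i) => [a|] F2 /=.
    by rewrite (matches_nth x0 mt1 F1) (matches_nth x0 mt2 (esym F2)) eqxx.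
  apply: negbTE; apply: fill_differ => //; by rewrite q1n.
rewrite cardsD (setIidPr PQ).
by rewrite (nfix_card q1n) (nfix_card p1n).
Qed.

End Agreement.

Local Close Scope ring_scope.

(** * Parameters *)

Section LogBound.
Local Open Scope R_scope.

Lemma INR_exp2 t : INR (2 ^ t)%N = 2 ^ t.
Proof.
elim: t => [|t IH]; first by [].
by rewrite expnS mult_INR IH.
Qed.

(** The factor 2 in the hypothesis pays for the change to base 2, since [ln 2 > 1/2]. *)
Lemma log_bound (N m n : nat) : (0 < m)%N -> INR (2 * N) * ln (INR m) <= INR n ->
  (N * trunc_log 2 m <= n)%N.
Proof.
move=> m0 H; set t := trunc_log 2 m.
have tm : (2 ^ t <= m)%N by exact: trunc_logP.
have tR : 2 ^ t <= INR m by rewrite -INR_exp2; apply: le_INR; apply/ssrnat.leP.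
have p2 : 0 < 2 ^ t by apply: pow_lt; Lra.lra.
have lt2 : INR t * ln 2 <= ln (INR m).
  rewrite -ln_pow; last by Lra.lra.
  by case: tR => [/(ln_increasing _ _ p2)/Rlt_le|->]; last exact: Rle_refl.
have N0 := pos_INR N; have t0 := pos_INR t; have l2 := ln_lt_2.
apply/ssrnat.leP; apply: INR_le; rewrite mult_INR.
rewrite mult_INR [INR 2]/= in H.
have h1 : INR t * / 2 <= INR t * ln 2 by apply: Rmult_le_compat_l => //; Lra.lra.
have h2 : INR N * (INR t * / 2) <= INR N * ln (INR m).
  by apply: Rmult_le_compat_l => //; Lra.lra.
Lra.lra.
Qed.

End LogBound.

Lemma linear_le_exp2 a t : (2 * a <= t)%N -> (a * t.+1 <= 2 ^ t)%N.
Proof.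
move=> at_; rewrite -(subnK at_); elim: (t - 2 * a)%N => [|d IH].
  rewrite add0n; clear; elim: a => [|a IH] //.
  have -> : (2 * a.+1)%N = (2 * a).+2 by lia.
  rewrite !expnS; move: IH; case: a => [|a] // IH; nia.
rewrite addSn expnS; move: IH; nia.
Qed.

Lemma large_root a c : exists l0, forall l, (l0 <= l)%N ->
  (c <= l)%N && (a * (trunc_log 2 l).+1 <= l)%N.
Proof.
exists (c + 2 ^ (2 * a))%N => l ll; apply/andP; split.
  by apply: leq_trans ll; rewrite leq_addr.
have l1 : (2 ^ (2 * a) <= l)%N by apply: leq_trans ll; rewrite leq_addl.
have lp : (0 < l)%N by apply: leq_trans l1; rewrite expn_gt0.
apply: leq_trans (trunc_logP (ltnSn 1) lp); apply: linear_le_exp2.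
exact: trunc_log_max.
Qed.

Lemma integer_root E m : (0 < E)%N -> (0 < m)%N ->
  exists l, (l ^ E <= m)%N && (m < l.+1 ^ E)%N.
Proof.
move=> E0 m0.
have ex : exists l, (l ^ E <= m)%N by exists 0%N; rewrite exp0n.
have bd l : (l ^ E <= m)%N -> (l <= m)%N.
  apply: leq_trans; case: l => // l.
  by rewrite -[X in (X <= _)%N]expn1 leq_pexp2l.
case: (ex_maxnP ex bd) => l lm lmax; exists l; rewrite lm /= ltnNge.
by apply/negP => /lmax; rewrite ltnn.
Qed.

Lemma enough_coordinates a c s t t' : t <= t' -> 0 < t' ->
  a + (2 * (c * t.+1 + 1) + s) <= (a + s + 4 * c + 2) * t'.
Proof.
move=> tt t0.
have h1 : c * t <= c * t' by rewrite leq_mul2l tt orbT.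
have h2 : a + s + 2 <= (a + s + 2) * t' by rewrite leq_pmulr.
have h3 : c <= c * t' by rewrite leq_pmulr.
have -> : (a + s + 4 * c + 2) * t' = (a + s + 2) * t' + 4 * (c * t') by ring.
have -> : c * t.+1 = c * t + c by rewrite mulnS addnC.
move: h1 h2 h3; move: (c * t) (c * t') ((_ + _) * _) => x y z; lia.
Qed.


Lemma exponent_le e k s x (E := e + 2 * k + 2 * s + 2 * x + 4) :
  2 + e + (E + 2 * k + 1) + 2 * s + 2 * x <= (2 * E).-1.
Proof. rewrite /E; lia. Qed.

Lemma leq_expn_base a b j : a <= b -> a ^ j <= b ^ j.
Proof. by move=> ab; case: j => // j; rewrite leq_exp2r. Qed.

(** * Densities and the final comparison of exponents *)

Section Numerics.
Local Open Scope ring_scope.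

Lemma delta_bounds (l m j k : nat) : (0 < m)%N -> (m ^ k <= l ^ j)%N ->
  let delta : rat := (m ^ k)%:R^-1 in 0 < delta /\ 1 <= delta * l%:R ^+ j.
Proof.
move=> m0 mj delta.
have P : 0 < (m ^ k)%:R :> rat by rewrite ltr0n expn_gt0 m0.
split; first by rewrite invr_gt0.
by rewrite mulrC ler_pdivlMr // mul1r -natrX ler_nat.
Qed.

(** As [2 * mu >= delta >= l ^ -j], the bound on [2 ^ h] leaves a factor [l ^ (s + 2)], and
    [l ^ 2 >= 4] beats the constant 2. *)
Lemma density_bound (l j s h : nat) (delta mu : rat) : (1 < l)%N ->
  (2 * l ^ (j + s + 2) <= 2 ^ h)%N -> 0 < delta -> 1 <= delta * l%:R ^+ j ->
  delta <= 2 * mu -> 2 * l%:R ^+ s < mu * 2 ^+ h.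
Proof.
move=> l2 hb d0 dE dmu.
have l0 : 0 < l%:R :> rat by rewrite ltr0n ltnW.
have hR : 2 * (l%:R ^+ j * l%:R ^+ s * l%:R ^+ 2) <= 2 ^+ h :> rat.
  by rewrite -!exprD -!natrX -natrM ler_nat.
have mu0 : 0 < mu by lra.
have h1 : mu * (2 * (l%:R ^+ j * l%:R ^+ s * l%:R ^+ 2)) <= mu * 2 ^+ h by rewrite ler_pM2l.
apply: lt_le_trans h1.
have ls : 0 < l%:R ^+ s :> rat by rewrite exprn_gt0.
have -> : mu * (2 * (l%:R ^+ j * l%:R ^+ s * l%:R ^+ 2)) =
  (2 * mu * l%:R ^+ j) * l%:R ^+ 2 * l%:R ^+ s by ring.
rewrite ltr_pM2r //.
have a1 : 1 <= 2 * mu * l%:R ^+ j.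
  by apply: le_trans dE _; rewrite ler_pM2r // exprn_gt0.
have a2 : 4 <= l%:R ^+ 2 :> rat by rewrite -natrX (ler_nat _ 4); exact: (leq_expn_base 2 l2).
have a3 : l%:R ^+ 2 <= (2 * mu * l%:R ^+ j) * l%:R ^+ 2.
  by rewrite ler_peMl // ltW // exprn_gt0.
lra.
Qed.

(** All losses become powers of [l]: one each for [C] and for the choice [K = l], [e] for the base,
    [a + s] and [s] from [gam1] and [gam2], and [e * s] twice for the fixed agreements. *)
Lemma final_inequality (l m C e a s N : nat) (gam1 gam2 mu1 mu2 nu1 : rat) :
  (0 < l)%N -> (C <= l)%N -> 0 < mu1 -> 0 < mu2 -> 0 <= gam1 -> 0 <= gam2 ->
  gam1 <= l%:R ^+ a * nu1 -> nu1 <= l%:R ^+ s * mu1 -> gam2 <= l%:R ^+ s * mu2 ->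
  (l ^ N + 1 < m)%N -> (2 + e + a + 2 * s + 2 * (e * s) <= N)%N ->
  C%:R * l%:R ^+ e * l%:R * (gam1 * (l%:R ^+ e) ^+ s * (gam2 * (l%:R ^+ e) ^+ s))
    < (m%:R - 1) * (mu1 * mu2).
Proof.
move=> l0 Cl p1 p2 g10 g20 g1 g12 g2 lm eN.
have lP j : 0 < l%:R ^+ j :> rat by rewrite exprn_gt0 // ltr0n.
have lP' j : 0 <= l%:R ^+ j :> rat by exact: ltW.
have h1 : gam1 <= l%:R ^+ a * (l%:R ^+ s * mu1).
  by apply: le_trans g1 _; rewrite ler_pM2l.
have h2 : gam1 * gam2 <= (l%:R ^+ a * (l%:R ^+ s * mu1)) * (l%:R ^+ s * mu2).
  exact: ler_pM.
have CR : C%:R <= l%:R :> rat by rewrite ler_nat.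
have -> : C%:R * l%:R ^+ e * l%:R * (gam1 * (l%:R ^+ e) ^+ s * (gam2 * (l%:R ^+ e) ^+ s))
   = C%:R * (gam1 * gam2) * (l%:R ^+ e * l%:R * l%:R ^+ (e * s) * l%:R ^+ (e * s)).
  by rewrite exprM; ring.
apply: (@le_lt_trans _ _ ((l%:R * (l%:R ^+ a * (l%:R ^+ s * mu1) * (l%:R ^+ s * mu2)))
    * (l%:R ^+ e * l%:R * l%:R ^+ (e * s) * l%:R ^+ (e * s)))).
  rewrite ler_wpM2r //; first by rewrite !mulr_ge0 // ler0n.
  by apply: ler_pM => //; rewrite ?ler0n // mulr_ge0.
have -> : l%:R * (l%:R ^+ a * (l%:R ^+ s * mu1) * (l%:R ^+ s * mu2)) *
   (l%:R ^+ e * l%:R * l%:R ^+ (e * s) * l%:R ^+ (e * s)) =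
   l%:R ^+ (2 + e + a + 2 * s + 2 * (e * s)) * (mu1 * mu2).
  rewrite !exprD expr0 expr2; ring.
rewrite ltr_pM2r ?mulr_gt0 // ltrBrDr -natrX -(natrD _ _ 1) ltr_nat.
apply: leq_ltn_trans lm; rewrite leq_add2r.
by rewrite leq_pexp2l.
Qed.

End Numerics.

Theorem theorem6p4 (s k : nat) :
  exists r m0 N : nat,
  forall (m n : nat) (R1 R2 : {set 'I_n})
         (A1 : {set {ffun coords n R1 -> 'I_m}})
         (A2 : {set {ffun coords n R2 -> 'I_m}}),
    m0 <= m ->
    Rle (Rmult (INR N) (ln (INR m))) (INR n) ->
    #|R1| <= k -> #|R2| <= k ->
    uncapturable r (((m ^ k)%:R)^-1)%R A1 ->
    uncapturable r (((m ^ k)%:R)^-1)%R A2 ->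
    exists x1 x2, x1 \in A1 /\ x2 \in A2 /\ #|agree_set x1 x2| = s.
Proof.
(* The bases of the two spread families are [l] and [l ^ e], where
   [l ^ (2 * E) <= m <= l ^ (4 * E)]; the choice of [e] keeps the second
   restriction below [E] coordinates, and [E] exceeds all other losses. *)
set e := 4 * k.+1; set E := e + 2 * k + 2 * s + 2 * (e * s) + 4.
(* This exponent suits densities of at least [m ^ -k >= l ^ -(4 * E * k)] with [K = l]; [C] depends
   on [s] and [k] only. *)
have [C HC] := everywhere_different_pair rat (4 * E * k).
set kap := 4 * E * k + s + 2.
have [l0 Hl0] := large_root (2 * kap + 2) (2 + C + 2 * (E + 2 * k)).
(* [r] bounds the coordinates fixed by [p0], hence the removed dictators; [m0] forces [l0 <= l]; [N]
   provides the coordinates fixed by [p1] and [2 * h + s] free ones. *)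
exists (4 * E * k), (l0 ^ (2 * E) + 2), (2 * (4 * E * k + 2 * k + E + s + 4 * kap + 2)).
move=> m n R1 R2 A1 A2 m0 nlog R1k R2k U1 U2.
have m2 : 2 <= m by apply: leq_trans m0; rewrite leq_addl.
have m_gt0 : 0 < m by apply: leq_trans m2.
pose x0 : 'I_m := Ordinal m_gt0.
have E0 : 0 < E by rewrite /E addnS.
have E20 : 0 < 2 * E by rewrite muln_gt0.
have [l /andP[lm ml]] := integer_root E20 m_gt0.
have l0l : l0 <= l.
  rewrite -ltnS -(ltn_exp2r _ _ E20); apply: leq_ltn_trans ml.
  by apply: leq_trans m0; rewrite leq_addr.
have /andP[cl al] := Hl0 l l0l.
have l2 : 2 <= l by apply: leq_trans cl; rewrite -addnA leq_addr.
have Cl : C <= l by apply: leq_trans cl; rewrite addnAC leq_addl.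
have El : 2 * (E + 2 * k) <= l by apply: leq_trans cl; rewrite leq_addl.
have l_gt0 : 0 < l by apply: leq_trans l2.
set t := trunc_log 2 l in al.
(* Since [l < 2 ^ t.+1], this gives [2 * l ^ kap <= 2 ^ h], while [h] stays logarithmic in [l]. *)
set h := kap * t.+1 + 1.
have hl : 2 * h <= l by apply: leq_trans al; rewrite /h; clear; nia.
have tm : t <= trunc_log 2 m.
  apply: leq_trunc_log; apply: leq_trans lm.
  by rewrite -[X in X <= _]expn1 leq_pexp2l.
have t1 : 1 <= trunc_log 2 m by rewrite trunc_log_gt0.
have nbig : 4 * E * k + 2 * k + E + (2 * h + s) <= n.
  by apply: leq_trans (log_bound m_gt0 nlog); exact: enough_coordinates.
have l_sq : l.+1 <= l ^ 2.
  by apply: (@leq_trans (l * 2)); rewrite ?leq_mul2l ?l2 ?orbT // muln2 -addnn -addn1 leq_add2l.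
have m_le : m ^ k <= l ^ (4 * E * k).
  rewrite expnM leq_expn_base //.
  apply: leq_trans (ltnW ml) _; rewrite (_ : 4 * E = 2 * (2 * E)); last by rewrite mulnA.
  by rewrite [X in _ <= X]expnM leq_expn_base.
have lE1 : l ^ (2 * E).-1 + 1 < m.
  have X0 : 0 < (2 * E).-1 by rewrite /E addnS mulnS.
  apply: leq_trans lm; rewrite -[X in _ <= l ^ X](prednK E20).
  move: X0; move: (2 * E).-1 => X X0; rewrite expnS.
  apply: (@leq_trans (2 * l ^ X)); last by rewrite leq_mul2r l2 orbT.
  rewrite mul2n -addnn -addnS leq_add2l; apply: leq_trans l2 _.
  by rewrite -[X in X <= _]expn1 leq_pexp2l.
have lT : 2 * (E + 2 * k) * l <= #|'I_m|.
  rewrite card_ord; apply: leq_trans lm; apply: (@leq_trans (l ^ 2)).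
    by rewrite leq_mul2r El orbT.
  by rewrite leq_pexp2l // -{1}(muln1 2) leq_mul2l.
have h_big : 2 * l ^ kap <= 2 ^ h.
  rewrite /h addn1 expnS leq_mul2l /= mulnC expnM leq_expn_base //.
  by apply: ltnW; exact: trunc_log_ltn.
pose delta : rat := ((m ^ k)%:R^-1)%R.
have [d0 dE] := delta_bounds m_gt0 m_le; rewrite -/delta in d0 dE.
have key mu : (delta <= 2 * mu -> 2 * l%:R ^+ s < mu * 2 ^+ h)%R.
  exact: (density_bound l2 h_big d0 dE).
pose f1 := cylinder x0 (A1 :\: dict_union set0).
pose F2 p := cylinder x0 (A2 :\: dict_union (clash R2 p)).
have := @aligned_patterns rat 'I_m x0 l e E k n (R1 :|: R2) f1 F2 delta l2 (leqnn _).
case=> //.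
- apply: leq_trans (leq_card_setU _ _) _; by rewrite mul2n -addnn leq_add.
- exact: cylinder_bounds.
- by rewrite -/(avg n _) avg_cylinder; apply: (uncapturable_lt U1); rewrite cards0.
- by move=> p; exact: cylinder_bounds.
- move=> p i w; rewrite inE negb_or => /andP[_ iR2]; exact: cylinder_clash.
- move=> p pn pE; rewrite -/(avg n _) avg_cylinder; apply: (uncapturable_lt U2).
  exact: leq_trans (card_clash R2 pn) pE.
move=> p0 [p1 [p2 [f1' [gam [[p1n sp np1] [inG outG] f1'b [hs1 g1 dg d1] [hs2 d2]]]]]].
have f1'01 w : (0 <= f1' w <= 1)%R.
  have /andP[-> fw] := f1'b w; apply: le_trans fw _.
  by case/andP: (cylinder_bounds x0 (A1 :\: dict_union set0) w).
have f2b w : (0 <= F2 p0 w <= 1)%R by exact: cylinder_bounds.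
have nf1 : 2 * h + s <= nfree p1.
  rewrite -(leq_add2l (nfix p1)) nfix_nfree p1n; apply: leq_trans nbig.
  by rewrite leq_add2r.
have d2' : (delta <= 2 * pavg p2 (F2 p0))%R.
  by apply: le_trans (ltW d2) _; rewrite ler_peMl // (le_trans (ltW d0) (ltW d2)).
have [q1 [q2 [[e1 e2] sq [n1 n2] [m1 mm2] agr]]] :=
  agreeing_extension x0 l_gt0 hl sp nf1 f1'01 f2b (key _ d1) (key _ d2').
have nfq : nfree q2 = nfree q1.
  have E1 q : nfree q = count negb (map isSome q) by rewrite count_map.
  by rewrite !E1 sq.
pose L : rat := (l%:R ^+ e)%R.
have lR : (1 <= l%:R :> rat)%R by rewrite ler1n.
have L1 : (1 <= L)%R by rewrite exprn_ege1.
have L0 : (0 < L)%R by apply: lt_le_trans L1.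
have LS : (1 <= L ^+ s)%R by rewrite exprn_ege1.
have hq1 := pspread_ext L0 e1 hs1; have hq2 := pspread_ext L0 e2 hs2.
rewrite n1 addKn in hq1; rewrite n2 addKn in hq2.
have mu1 : (0 < pavg q1 f1')%R.
  have : (0 < 2 * (l%:R ^+ s * pavg q1 f1') :> rat)%R.
    by apply: lt_le_trans d0 _; apply: le_trans d1 _; rewrite ler_pM2l.
  by rewrite !pmulr_rgt0 ?exprn_gt0 // ?ltr0n.
have mu2 : (0 < pavg q2 (F2 p0))%R.
  have : (0 < l%:R ^+ s * pavg q2 (F2 p0) :> rat)%R.
    by apply: lt_le_trans d0 _; apply: le_trans (ltW d2) _.
  by rewrite pmulr_rgt0 ?exprn_gt0 // ltr0n.
(* With [K = l], the lower bound on [gam] required by [everywhere_different_pair] follows from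
   [delta <= g]. *)
have gam_ok g : (delta <= g -> 0 < g * L ^+ s /\ 1 <= l%:R ^+ (4 * E * k).+1 * (g * L ^+ s))%R.
  move=> dg'; have g0 : (0 < g)%R by apply: lt_le_trans dg'.
  split; first by rewrite mulr_gt0 // exprn_gt0.
  apply: le_trans dE _; rewrite mulrC; apply: ler_pM => //.
  - by rewrite exprn_ge0 // ler0n.
  - exact: ltW.
  - by rewrite ler_weXn2l.
  - by apply: le_trans dg' _; rewrite ler_peMr // ltW.
have [g10 g1k] := gam_ok _ dg; have [g20 g2k] := gam_ok _ (ltW d2).
have := HC 'I_m x0 (nfree q1) (fun y => f1' (fill x0 q1 y)) (fun y => F2 p0 (fill x0 q2 y))
  L l%:R%R _ _ L1 lR g10 g20 g1k g2k.
case=> [y _|y _||||y1 [y2 [s1 s2 fy1 fy2 y12]]].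
- exact: f1'01.
- exact: f2b.
- exact: pspread_fill.
- by rewrite -nfq; exact: pspread_fill.
- rewrite -{2}nfq !avg_fill card_ord.
  apply: (final_inequality l_gt0 Cl mu1 mu2 _ _ g1 m1 mm2 lE1).
  + exact: le_trans (ltW d0) dg.
  + exact: ltW (lt_trans d0 d2).
  + exact: exponent_le.
exists (proj x0 R1 (fill x0 q1 y1)), (proj x0 R2 (fill x0 q2 y2)); split; last split.
- have := lt_le_trans fy1 (proj2 (andP (f1'b _))).
  by rewrite /f1 /cylinder inE; case: (proj _ _ _ \in A1); rewrite ?andbF.
- by move: fy2; rewrite /F2 /cylinder inE; case: (proj _ _ _ \in A2); rewrite ?andbF.
rewrite (agree_set_card x0 p1n e1 e2 sp sq inG outG agr s1) ?nfq //.
by rewrite n1 addKn.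
Qed.
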